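(* Let $W=(U,A_0,L,A_1,Y)$ and let $V=(A_0,A_1,L,Y)$ be the observed variables. Suppose the joint distribution of $W$ is represented by DAG 1b (defined in the context), and that it is either faithful or linearly faithful to DAG 1b. Consider the parametric models $$Y\mid A_0=a_0,A_1=a_1,L=\ell\ \sim\ N(\theta_0+\theta_1a_0+\theta_2\ell+\theta_3a_1,\ \sigma^2)\qquad\text{(M1)}$$ with $(\theta_0,\theta_1,\theta_2,\theta_3)\in\mathbb{R}^4$, $\sigma^2>0$, and $$\Pr(L=1\mid A_0=a_0)=\frac{e^{\gamma_0+\gamma_1a_0}}{1+e^{\gamma_0+\gamma_1a_0}}\qquad\text{(M2)}$$ with $(\gamma_0,\gamma_1)\in\mathbb{R}^2$. Then at least one of the models (M1), (M2) is misspecified. That is, the set $\mathcal{F}_{par}$ of distributions for $V$ that satisfy (M1) and (M2) for some parameter values is disjoint from the set $\mathcal{F}_{mar}$ of distributions for $V$ that are marginals of distributions for $W$ which are represented by DAG 1b and are either faithful or linearly faithful to DAG 1b.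
   Context: Variables: $A_0,A_1,Y$ are continuous real random variables, $L$ is binary with values in $\{0,1\}$, and $U$ is a hidden (unobserved) real random variable. The joint distribution of $W$ has a density with respect to a product of Lebesgue measures (continuous components) and counting measures (discrete components). DAG 1b is the directed acyclic graph on $\{U,A_0,L,A_1,Y\}$ with exactly the arrows $A_0\to L$, $A_0\to A_1$, $U\to L$, $U\to Y$, $L\to A_1$. (It represents the null hypothesis that the treatments $(A_0,A_1)$ have no effect on $Y$.) A distribution is represented by a DAG if its density factors as the product over the vertices of the conditional density of each variable given its parents. Faithfulness: the distribution of $W$ is faithful to the DAG if for all disjoint (possibly empty) subsets $B,C,D$ of the variables in $W$, $B\perp\!\!\!\perp C\mid D$ if and only if $B$ is d-separated from $C$ given $D$ in the DAG. Linear faithfulness: the distribution of $W$ (with finite second moments) is linearly faithful to the DAG if for all disjoint (possibly empty) subsets $B,C,D$ of the variables in $W$, $B$ is d-separated from $C$ given $D$ in the DAG if and only if the partial correlation matrix between $B$ and $C$ given $D$ is the zero matrix. A parametric model for a conditional density is correctly specified if some parameter value gives the true conditional density; otherwise it is misspecified. *)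

(* Defs.v *)
From HB Require Import structures.
From mathcomp Require Import all_boot all_order all_algebra.
From mathcomp Require Import all_classical all_reals all_analysis.
Set Implicit Arguments.
Unset Strict Implicit.
Unset Printing Implicit Defensive.
Import Order.TTheory GRing.Theory Num.Theory.
Import numFieldNormedType.Exports.
Local Open Scope classical_set_scope.
Local Open Scope ring_scope.

Section DSeparation.
Variables (I : finType) (e : rel I).

Definition parents (i : I) : {set I} := [set j | e j i]%SET.

(* Reflexive-transitive closure: y is counted among its own descendants. *)
Definition descendant_in (D : {set I}) (y : I) : bool :=
  [exists d in D, connect e y d].

Definition triple_blocked (D : {set I}) (x y z : I) : bool :=
  if e x y && e z y then ~~ descendant_in D y else y \in D.

Fixpoint blocked (D : {set I}) (p : seq I) : bool :=
  if p is x :: q then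
    (if q is y :: z :: _ then triple_blocked D x y z else false) || blocked D q
  else false.

Definition d_separated (B C D : {set I}) : Prop :=
  forall (b : I) (p : seq I),
    b \in B -> last b p \in C -> uniq (b :: p) ->
    path (fun x y => e x y || e y x) b p -> blocked D (b :: p).

End DSeparation.

Section Probability.
Context {d : measure_display} {T : measurableType d} {R : realType}.
Variable P : probability T R.

Definition has_density (mu : {measure set T -> \bar R}) (f : T -> R) : Prop :=
  [/\ measurable_fun setT f, forall w, 0 <= f w &
   forall E, measurable E -> P E = (\int[mu]_(w in E) (f w)%:E)%E].

(* g is a version of the conditional probability of E given the
   sub-sigma-algebra G. *)
Definition is_cond_prob (G : set (set T)) (E : set T) (g : T -> R) : Prop :=
  [/\ preimage_set_system setT g measurable `<=` G,
      P.-integrable setT (EFin \o g) &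
      forall F, G F -> (\int[P]_(w in F) (g w)%:E)%E = P (E `&` F)].

Section Family.
Variables (I : Type) (X : I -> T -> R).

(* The sigma-algebra generated by the variables X i, i in D. *)
Definition sigma_of (D : set I) : set (set T) :=
  <<s \bigcup_(i in D) preimage_set_system setT (X i) measurable >>.

Definition cond_indep (B C D : set I) : Prop :=
  forall E F, sigma_of B E -> sigma_of C F ->
  exists gE gF gEF : T -> R,
    [/\ is_cond_prob (sigma_of D) E gE, is_cond_prob (sigma_of D) F gF,
        is_cond_prob (sigma_of D) (E `&` F) gEF &
        {ae P, forall w, gEF w = gE w * gF w}].

(* k z w is a version, at z, of the conditional density with respect to nu of
   Z given the X i, i in D, these variables taking their values at w. *)
Definition is_cond_density (nu : {measure set (measurableTypeR R) -> \bar R})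
    (Z : T -> R) (D : set I) (k : R -> T -> R) : Prop :=
  [/\ measurable_fun setT (fun p : measurableTypeR R * T => k p.1 p.2),
      forall z w, 0 <= k z w,
      forall z w w', (forall i, D i -> X i w = X i w') -> k z w = k z w' &
      forall (A : set (measurableTypeR R)) E, measurable A -> sigma_of D E ->
        P (Z @^-1` A `&` E) =
        (\int[P]_(w in E) \int[nu]_(z in A) (k z w)%:E)%E].

End Family.

Section FiniteFamily.
Variables (I : finType) (X : I -> T -> R) (e : rel I).

(* nu i is the reference measure of X i, mu that of the joint distribution. *)
Definition represented (nu : I -> {measure set (measurableTypeR R) -> \bar R})
    (mu : {measure set T -> \bar R}) : Prop :=
  exists k : I -> R -> T -> R,
    (forall i, is_cond_density X (nu i) (X i) [set` parents e i] (k i)) /\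
    has_density mu (fun w => \prod_i k i (X i w) w).

Definition faithful : Prop :=
  forall B C D : {set I},
    B :&: C = finset.set0 -> B :&: D = finset.set0 -> C :&: D = finset.set0 ->
    (cond_indep X [set` B] [set` C] [set` D] <-> d_separated e B C D).

Definition covmx (B C : {set I}) : 'M[R]_(#|B|, #|C|) :=
  \matrix_(i, j) fine (covariance P (X (enum_val i)) (X (enum_val j))).

(* Covariance of the residuals of the linear regressions on D.  The rows of
   covmx B D lie in the row space of covmx D D, so that pinvmx, which is the
   inverse when covmx D D is invertible, also handles the degenerate case. *)
Definition partial_covmx (B C D : {set I}) : 'M[R]_(#|B|, #|C|) :=
  covmx B C - covmx B D *m pinvmx (covmx D D) *m covmx D C.

(* An entry is 0 when one of the two residual variances vanishes. *)
Definition partial_corrmx (B C D : {set I}) : 'M[R]_(#|B|, #|C|) :=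
  \matrix_(i, j) (partial_covmx B C D i j /
    (Num.sqrt (partial_covmx B B D i i) * Num.sqrt (partial_covmx C C D j j))).

Definition linearly_faithful : Prop :=
  (forall i, P.-integrable setT (EFin \o (fun w => X i w ^+ 2))) /\
  forall B C D : {set I},
    B :&: C = finset.set0 -> B :&: D = finset.set0 -> C :&: D = finset.set0 ->
    (d_separated e B C D <-> partial_corrmx B C D = 0).

End FiniteFamily.
End Probability.

Inductive wvar := wU | wA0 | wL | wA1 | wY.

Definition wvar_code (v : wvar) : option (bool * bool) :=
  match v with
  | wU => None
  | wA0 => Some (false, false)
  | wL => Some (false, true)
  | wA1 => Some (true, false)
  | wY => Some (true, true)
  end.

Definition wvar_decode (c : option (bool * bool)) : wvar :=
  match c with
  | None => wU
  | Some (false, false) => wA0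
  | Some (false, true) => wL
  | Some (true, false) => wA1
  | Some (true, true) => wY
  end.

Lemma wvar_codeK : cancel wvar_code wvar_decode. Proof. by case. Qed.

HB.instance Definition _ := Finite.copy wvar (can_type wvar_codeK).

Inductive vvar := vA0 | vA1 | vL | vY.

Definition DAG1b : rel wvar := fun x y =>
  match x, y with
  | wA0, wL | wA0, wA1 | wU, wL | wU, wY | wL, wA1 => true
  | _, _ => false
  end.

Section Spaces.
Variable R : realType.
Local Notation mR := (measurableTypeR R).

(* Values (u, a0, l, a1, y) of W. *)
Definition wspace : Type := (mR * mR * mR * mR * mR)%type.
HB.instance Definition _ := Measurable.on wspace.

(* Values (a0, a1, l, y) of V. *)
Definition vspace : Type := (mR * mR * mR * mR)%type.
HB.instance Definition _ := Measurable.on vspace.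

Definition wcoord (i : wvar) (w : wspace) : R :=
  let: (u, a0, l, a1, y) := w in
  match i with wU => u | wA0 => a0 | wL => l | wA1 => a1 | wY => y end.

Definition vcoord (i : vvar) (v : vspace) : R :=
  let: (a0, a1, l, y) := v in
  match i with vA0 => a0 | vA1 => a1 | vL => l | vY => y end.

Definition observed (w : wspace) : vspace :=
  (wcoord wA0 w, wcoord wA1 w, wcoord wL w, wcoord wY w).

Lemma measurable_01 : measurable ([set 0; 1] : set mR).
Proof. by apply: measurableU; exact: measurable_set1. Qed.

Lemma counting_01_fin : (@counting mR R [set 0%R; 1%R] < +oo)%E.
Proof. by rewrite /counting asboolT ?ltry//; exact: finite_set2. Qed.

Definition counting01 : {finite_measure set mR -> \bar R} :=
  mfrestr measurable_01 counting_01_fin.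

(* W has a density with respect to nuU, Lebesgue measure, counting measure on
   {0, 1}, Lebesgue measure and Lebesgue measure, where nuU is the reference
   measure of the hidden variable, which may be continuous or discrete. *)
Definition hidden_reference (nuU : {sigma_finite_measure set mR -> \bar R}) :
    Prop :=
  (forall A : set mR, measurable A -> nuU A = lebesgue_measure A) \/
  exists2 S : set mR, countable S &
    forall A : set mR, measurable A -> nuU A = counting (A `&` S).

Definition wref (nuU : {sigma_finite_measure set mR -> \bar R}) (i : wvar) :
    {measure set mR -> \bar R} :=
  match i with
  | wU => nuU
  | wL => counting01
  | wA0 | wA1 | wY => lebesgue_measure
  end.

Definition wmeasure (nuU : {sigma_finite_measure set mR -> \bar R}) :
    {measure set wspace -> \bar R} :=
  (nuU \x lebesgue_measure \x counting01 \x lebesgue_measure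
    \x lebesgue_measure)%E.

Definition vmeasure : {measure set vspace -> \bar R} :=
  (lebesgue_measure \x lebesgue_measure \x counting01 \x lebesgue_measure)%E.

Lemma measurable_wcoord (i : wvar) : measurable_fun [set: wspace] (wcoord i).
Proof.
have m4 : measurable_fun [set: wspace] fst := measurable_fst.
have m3 : measurable_fun [set: wspace] (fst \o fst) :=
  measurableT_comp measurable_fst m4.
have m2 : measurable_fun [set: wspace] (fst \o (fst \o fst)) :=
  measurableT_comp measurable_fst m3.
have -> : wcoord i =
    match i with
    | wU => fst \o (fst \o (fst \o fst))
    | wA0 => snd \o (fst \o (fst \o fst))
    | wL => snd \o (fst \o fst)
    | wA1 => snd \o fst
    | wY => snd
    end by apply/funext => -[[[[u a0] l] a1] y]; case: i.
case: i.
- exact: measurableT_comp measurable_fst m2.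
- exact: measurableT_comp measurable_snd m2.
- exact: measurableT_comp measurable_snd m3.
- exact: measurableT_comp measurable_snd m4.
- exact: measurable_snd.
Qed.

Lemma measurable_observed : measurable_fun setT observed.
Proof.
by do 3![apply: measurable_fun_pair; last exact: measurable_wcoord];
  exact: measurable_wcoord.
Qed.

HB.instance Definition _ :=
  isMeasurableFun.Build _ _ wspace vspace observed measurable_observed.

Definition represented_DAG1b (P : probability wspace R) : Prop :=
  exists2 nuU, hidden_reference nuU &
    represented P wcoord DAG1b (wref nuU) (wmeasure nuU).

Definition expit (x : R) : R := expR x / (1 + expR x).

Definition M1_correct (Q : probability vspace R) : Prop :=
  exists theta0 theta1 theta2 theta3 sigma2 : R, 0 < sigma2 /\
    is_cond_density Q vcoord lebesgue_measure (vcoord vY) [set vA0; vA1; vL]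
      (fun y v => normal_pdf
        (theta0 + theta1 * vcoord vA0 v + theta2 * vcoord vL v
          + theta3 * vcoord vA1 v) (Num.sqrt sigma2) y).

Definition M2_correct (Q : probability vspace R) : Prop :=
  exists gamma0 gamma1 : R,
    is_cond_prob Q (sigma_of vcoord [set vA0]) (vcoord vL @^-1` [set 1])
      (fun v => expit (gamma0 + gamma1 * vcoord vA0 v)).

Definition F_par : set (probability vspace R) :=
  [set Q | (exists f, has_density Q vmeasure f) /\
           M1_correct Q /\ M2_correct Q].

Definition F_mar : set (probability vspace R) :=
  [set Q | exists P : probability wspace R,
    [/\ represented_DAG1b P,
        faithful P wcoord DAG1b \/ linearly_faithful P wcoord DAG1b &
        forall E, measurable E -> Q E = distribution P observed E]].

End Spaces.

Arguments wcoord {R}.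
Arguments vcoord {R}.
Arguments observed {R}.
Arguments F_par R : clear implicits.
Arguments F_mar R : clear implicits.

(* Main.v *)
(* Let p(a) = expit(gamma0 + gamma1 a), and suppose that (M1) and (M2) both hold.
   - In the DAG, Y and A1 are independent given (A0, L), and A1 has a conditional
     density.  So almost surely the Gaussian law of Y given (A0, L, A1) does not
     change as A1 varies over a set of positive Lebesgue measure: theta3 = 0.
   - In the DAG, Y and A0 are independent.  The law of Y given A0 = a is, by both
     models, the mixture
       p(a) N(theta0 + theta1 a + theta2, s^2) + (1 - p(a)) N(theta0 + theta1 a, s^2),
     and it is the same for almost every a.  Its upper tail determines the larger
     of the two means, hence theta1 = 0; then theta2 = 0 or p is constant.
   - If theta2 = 0 then Y and L are independent, and if gamma1 = 0 then A0 and L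
     are.  Neither pair is d-separated by the empty set, so both faithfulness and
     linear faithfulness fail. *)
From HB Require Import structures.
From mathcomp Require Import all_boot all_order all_algebra.
From mathcomp Require Import all_classical all_reals all_analysis measurable_realfun.
From mathcomp Require Import ring lra.
Require Import Defs.
Set Implicit Arguments.
Unset Strict Implicit.
Unset Printing Implicit Defensive.
Import Order.TTheory GRing.Theory Num.Theory.
Import numFieldNormedType.Exports.
Local Open Scope classical_set_scope.
Local Open Scope ring_scope.

(** * Densities and product measures *)

(** Two obstacles shape the argument. A conditional density is only a version, normalized outside a
    null set of parent values, so integrating a factor out of the DAG density is not an identity;
    the independence of A0 and Y is therefore extracted from upper bounds, for a set and for its
    complement. Moreover, conditional laws are never formed: each model enters as an equality of
    integrals over arbitrary measurable sets, which yields pointwise equalities almost everywhere.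
    Testing Y only on the half-lines [n, +oo[ keeps these equalities countable, so one null set
    serves all n, and it loses nothing: for a fixed variance, the density ratio of two Gaussians is
    exponential in y, so the tail with the larger mean eventually exceeds any multiple of the other.
    The weights of the mixture lie strictly between 0 and 1, so its larger mean always carries mass,
    and that mean is the affine function theta0 + theta1 a shifted by max(0, theta2), which does not
    involve a. For linear faithfulness a zero covariance is needed: L is almost surely an indicator,
    so independence from the event L = 1 and finite second moments suffice. *)

Section Density.
Context d (T : measurableType d) (R : realType).
Variables (mu nu : {measure set T -> \bar R}) (f : T -> R).
Hypothesis mf : measurable_fun setT f.
Hypothesis f0 : forall x, 0 <= f x.
Hypothesis nuE : forall E, measurable E -> nu E = (\int[mu]_(x in E) (f x)%:E)%E.
Import HBNNSimple.
Local Open Scope ereal_scope.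

(** A simple function is a finite combination of indicators of its level sets, and on each of them
    the claim is [nuE]. Monotone convergence then reaches every nonnegative measurable function. *)
Let nnsfun_density (h : {nnsfun T >-> R}) :
  \int[nu]_x (h x)%:E = \int[mu]_x ((h x)%:E * (f x)%:E).
Proof.
have mF : measurable_fun setT (EFin \o f) by exact/measurable_EFinP.
rewrite integralT_nnsfun sintegralE.
transitivity (\int[mu]_x (\sum_(r \in range h)
    (r%:E * ((\1_(h @^-1` [set r]) x)%:E * (f x)%:E)))); last first.
  apply: eq_integral => x _; under eq_fsbigr => r _ do rewrite muleA -(EFinM r).
  rewrite -ge0_mule_fsuml => [|y]; last exact: nnfun_muleindic_ge0.
  by rewrite fsumEFin// -(fimfunE h x).
have mi r : measurable_fun setT
    (fun x => (\1_(h @^-1` [set r]) x)%:E * (f x)%:E : \bar R).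
  by apply: emeasurable_funM => //; exact/measurable_EFinP.
rewrite ge0_integral_fsum//; last 2 first.
- by move=> r; exact: measurable_funeM.
- by move=> r x _; rewrite muleA mule_ge0 ?nnfun_muleindic_ge0 ?lee_fin.
apply: eq_fsbigr => r; rewrite inE => -[t _ <-].
rewrite ge0_integralZl//; [|by move=> x _; rewrite mule_ge0 ?lee_fin|by rewrite lee_fin].
congr *%E; rewrite nuE// integral_mkcond.
by apply: eq_integral => x _; rewrite epatch_indic muleC.
Qed.

Lemma ge0_integral_densityT (g : T -> \bar R) : measurable_fun setT g ->
  (forall x, 0 <= g x) -> \int[nu]_x g x = \int[mu]_x (g x * (f x)%:E).
Proof.
move=> mg g0; pose h := nnsfun_approx measurableT mg.
have hg x : (h n x)%:E @[n --> \oo] --> g x by exact: cvg_nnsfun_approx.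
have nd x a b : (a <= b)%N -> (h a x <= h b x)%R.
  by move=> ab; exact/lefP/nd_nnsfun_approx.
have -> : \int[nu]_x g x = limn (fun n => \int[nu]_x (h n x)%:E).
  rewrite -monotone_convergence//.
  - by apply: eq_integral => x _; apply/esym/cvg_lim => //; exact: hg.
  - by move=> n; exact/measurable_EFinP.
  - by move=> n x _; rewrite lee_fin.
  - by move=> x _ a b /nd; rewrite lee_fin.
have -> : \int[mu]_x (g x * (f x)%:E) =
    limn (fun n => \int[mu]_x ((h n x)%:E * (f x)%:E)).
  rewrite -monotone_convergence//.
  - by apply: eq_integral => x _; apply/esym/cvg_lim => //; exact: cvgeZr.
  - by move=> n; apply: emeasurable_funM; exact/measurable_EFinP.
  - by move=> n x _; rewrite mule_ge0 ?lee_fin.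
  - by move=> x _ a b /nd ab; apply: lee_wpmul2r; rewrite lee_fin.
by congr (limn _); apply/funext => n; exact: nnsfun_density.
Qed.

Lemma ge0_integral_density (g : T -> \bar R) E : measurable E ->
  measurable_fun setT g -> (forall x, 0 <= g x) ->
  \int[nu]_(x in E) g x = \int[mu]_(x in E) (g x * (f x)%:E).
Proof.
move=> mE mg g0; rewrite integral_mkcond [RHS]integral_mkcond.
rewrite ge0_integral_densityT.
- by apply: eq_integral => x _; rewrite /patch; case: ifP => // _; rewrite mul0e.
- by apply/(measurable_restrictT _ _).1 => //; exact: measurable_funTS.
- by move=> x; apply: erestrict_ge0 => y _.
Qed.

End Density.

Section SigmaFiniteProduct.
Context d1 d2 (T1 : measurableType d1) (T2 : measurableType d2) (R : realType).
Variables (m1 : {sigma_finite_measure set T1 -> \bar R})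
  (m2 : {sigma_finite_measure set T2 -> \bar R}).

(* The library's sigma-finite structure on [m1 \x m2] is shadowed by the one for
   subprobabilities, which inference finds first. *)
Definition sf_product : set (T1 * T2)%type -> \bar R := (m1 \x m2)%E.

HB.instance Definition _ := Measure.on sf_product.
HB.instance Definition _ := Measure_isSigmaFinite.Build _ _ _ sf_product
  (lebesgue_integral_fubini.product_measure_sigma_finite_subproof m1 m2).

End SigmaFiniteProduct.

Section Fubini.
Context d1 d2 d3 d4 d5 (T1 : measurableType d1) (T2 : measurableType d2)
  (T3 : measurableType d3) (T4 : measurableType d4) (T5 : measurableType d5)
  (R : realType).
Variables (m1 : {sigma_finite_measure set T1 -> \bar R})
  (m2 : {sigma_finite_measure set T2 -> \bar R})
  (m3 : {sigma_finite_measure set T3 -> \bar R})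
  (m4 : {sigma_finite_measure set T4 -> \bar R})
  (m5 : {sigma_finite_measure set T5 -> \bar R}).
Local Open Scope ereal_scope.

Lemma fubini_tonelli_prod5 (F : T1 * T2 * T3 * T4 * T5 -> \bar R) :
  measurable_fun setT F -> (forall w, 0 <= F w) ->
  \int[m1 \x m2 \x m3 \x m4 \x m5]_w F w =
  \int[m1]_x1 \int[m2]_x2 \int[m3]_x3 \int[m4]_x4 \int[m5]_x5
    F (x1, x2, x3, x4, x5).
Proof.
move=> mF F0.
pose m12 : {sigma_finite_measure set (T1 * T2)%type -> \bar R} :=
  sf_product m1 m2.
pose m123 : {sigma_finite_measure set (T1 * T2 * T3)%type -> \bar R} :=
  sf_product m12 m3.
pose m1234 : {sigma_finite_measure set (T1 * T2 * T3 * T4)%type -> \bar R} :=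
  sf_product m123 m4.
transitivity (\int[m1234 \x m5]_w F w); first by [].
have FF d d' (S : measurableType d) (S' : measurableType d')
    (m : {sigma_finite_measure set S' -> \bar R}) (G : S * S' -> \bar R) :
    measurable_fun setT G -> (forall w, 0 <= G w) ->
    measurable_fun setT (fubini_F m G) /\ (forall x, 0 <= fubini_F m G x).
  by move=> mG G0; split=> [|x]; [exact: measurable_fun_fubini_tonelli_F|exact: integral_ge0].
rewrite (fubini_tonelli1 _ mF F0).
have [mF4 F40] := FF _ _ _ _ m5 _ mF F0.
transitivity (\int[m123 \x m4]_w fubini_F m5 F w); first by [].
rewrite (fubini_tonelli1 _ mF4 F40).
have [mF3 F30] := FF _ _ _ _ m4 _ mF4 F40.
transitivity (\int[m12 \x m3]_w fubini_F m4 (fubini_F m5 F) w); first by [].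
rewrite (fubini_tonelli1 _ mF3 F30).
have [mF2 F20] := FF _ _ _ _ m3 _ mF3 F30.
transitivity (\int[m1 \x m2]_w fubini_F m3 (fubini_F m4 (fubini_F m5 F)) w); first by [].
by rewrite (fubini_tonelli1 _ mF2 F20).
Qed.
End Fubini.

Lemma ge0_integral_wmeasure (R : realType)
   (nuU : {sigma_finite_measure set (measurableTypeR R) -> \bar R})
    (F : wspace R -> \bar R) : measurable_fun setT F -> (forall w, 0 <= F w)%E ->
  (\int[wmeasure nuU]_w F w =
  \int[nuU]_u \int[lebesgue_measure]_a0 \int[counting01 R]_l
   \int[lebesgue_measure]_a1 \int[lebesgue_measure]_y
    F (u, a0, l, a1, y))%E.
Proof.
move=> mF F0; rewrite /wmeasure.
exact: (@fubini_tonelli_prod5 _ _ _ _ _ _ _ _ _ _ _ nuU lebesgue_measure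
  (counting01 R) lebesgue_measure lebesgue_measure F mF F0).
Qed.

Section FubiniMarginal.
Context d1 d2 d3 d4 d5 (T1 : measurableType d1) (T2 : measurableType d2)
  (T3 : measurableType d3) (T4 : measurableType d4) (T5 : measurableType d5)
  (R : realType).
Variables (m1 : {sigma_finite_measure set T1 -> \bar R})
  (m2 : {sigma_finite_measure set T2 -> \bar R})
  (m3 : {sigma_finite_measure set T3 -> \bar R})
  (m4 : {sigma_finite_measure set T4 -> \bar R})
  (m5 : {sigma_finite_measure set T5 -> \bar R}).
Local Open Scope ereal_scope.

Lemma fubini_tonelli_prod3 (F : T2 * T3 * T4 -> \bar R) :
  measurable_fun setT F -> (forall w, 0 <= F w) ->
  \int[sf_product (sf_product m2 m3) m4]_w F w =
  \int[m2]_x2 \int[m3]_x3 \int[m4]_x4 F (x2, x3, x4).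
Proof.
move=> mF F0; pose m23 : {sigma_finite_measure set (T2 * T3)%type -> \bar R} :=
  sf_product m2 m3.
transitivity (\int[m23 \x m4]_w F w); first by [].
rewrite (fubini_tonelli1 _ mF F0).
have mF2 : measurable_fun setT (fubini_F m4 F) by exact: measurable_fun_fubini_tonelli_F.
transitivity (\int[m2 \x m3]_w fubini_F m4 F w); first by [].
by rewrite (fubini_tonelli1 _ mF2)// => x; exact: integral_ge0.
Qed.

(** Tonelli moves the first integral inwards past the block of the three middle ones. In this order
    the outer variable is (A0, L, A1) while the hidden variable and the outcome are integrated out,
    which gives the marginal density needed for the coefficient of A1. *)
Lemma fubini_tonelli_marginal (F : T1 * T2 * T3 * T4 * T5 -> \bar R) :
  measurable_fun setT F -> (forall w, 0 <= F w) ->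
  \int[m1 \x m2 \x m3 \x m4 \x m5]_w F w =
  \int[sf_product (sf_product m2 m3) m4]_t \int[m1]_x1 \int[m5]_x5
    F (x1, t.1.1, t.1.2, t.2, x5).
Proof.
move=> mF F0; rewrite fubini_tonelli_prod5//.
pose m234 : {sigma_finite_measure set (T2 * T3 * T4)%type -> \bar R} :=
  sf_product (sf_product m2 m3 : {sigma_finite_measure set (T2 * T3)%type -> \bar R}) m4.
pose G (p : T1 * (T2 * T3 * T4)) :=
  \int[m5]_x5 F (p.1, p.2.1.1, p.2.1.2, p.2.2, x5).
have mG : measurable_fun setT G.
  apply: (@measurableT_comp _ _ _ _ _ _ (fubini_F m5 F) setT
    (fun p : T1 * (T2 * T3 * T4) => (p.1, p.2.1.1, p.2.1.2, p.2.2))).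
    exact: measurable_fun_fubini_tonelli_F.
  by do 3?apply: measurable_fun_pair => //; do 3?apply: measurableT_comp => //.
have G0 p : 0 <= G p by exact: integral_ge0.
transitivity (\int[m1]_x1 \int[m234]_t G (x1, t)).
  apply: eq_integral => x1 _; rewrite fubini_tonelli_prod3//.
  exact: measurable_fun_pair2.
by rewrite fubini_tonelli.
Qed.

End FubiniMarginal.

Section Chain.
Context d1 d2 d3 d4 d5 (T1 : measurableType d1) (T2 : measurableType d2)
  (T3 : measurableType d3) (T4 : measurableType d4) (T5 : measurableType d5)
  (R : realType).
Local Open Scope ereal_scope.

(** The integral of a nonnegative function is a supremum over the simple functions below it, so it
    is monotone without measurability. This spares the measurability of the inner integrals in
    [integral_chain_le]. *)
Lemma ge0_le_integral_nonmeasurable d (T : measurableType d)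
    (mu : {measure set T -> \bar R}) (f g : T -> \bar R) :
  (forall x, 0 <= f x) -> (forall x, f x <= g x) ->
  \int[mu]_x f x <= \int[mu]_x g x.
Proof.
move=> f0 fg; have g0 x : 0 <= g x by exact: le_trans (fg x).
rewrite ge0_integralE// [leRHS]ge0_integralE// !patch_setT.
apply: le_ereal_sup => _ [h hf <-]; exists h => // x.
exact: le_trans (fg x).
Qed.

Variables (m1 : {measure set T1 -> \bar R}) (m2 : {measure set T2 -> \bar R})
  (m3 : {measure set T3 -> \bar R}) (m4 : {measure set T4 -> \bar R})
  (m5 : {measure set T5 -> \bar R}).
Variables (f1 : T1 -> \bar R) (f2 : T2 -> \bar R) (f3 : T1 -> T2 -> T3 -> \bar R)
  (f4 : T2 -> T3 -> T4 -> \bar R) (f5 : T1 -> T5 -> \bar R).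
Hypotheses (f1_ge0 : forall x, 0 <= f1 x) (f2_ge0 : forall y, 0 <= f2 y)
  (f3_ge0 : forall x y z, 0 <= f3 x y z) (f4_ge0 : forall y z t, 0 <= f4 y z t)
  (f5_ge0 : forall x s, 0 <= f5 x s).
Hypotheses (mf1 : measurable_fun setT f1) (mf2 : measurable_fun setT f2)
  (mf3 : forall x y, measurable_fun setT (f3 x y))
  (mf4 : forall y z, measurable_fun setT (f4 y z))
  (mf5 : forall x, measurable_fun setT (f5 x))
  (mI5 : measurable_fun setT (fun x => \int[m5]_s f5 x s)).
Hypotheses (f3_le1 : forall x y, \int[m3]_z f3 x y z <= 1)
  (f4_le1 : forall y z, \int[m4]_t f4 y z t <= 1).

Lemma integral_chain_le :
  \int[m1]_x \int[m2]_y \int[m3]_z \int[m4]_t \int[m5]_s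
    (f1 x * (f2 y * (f3 x y z * (f4 y z t * f5 x s)))) <=
  \int[m2]_y f2 y * \int[m1]_x (f1 x * \int[m5]_s f5 x s).
Proof.
pose I5 x := \int[m5]_s f5 x s.
have I50 x : 0 <= \int[m5]_s f5 x s by exact: integral_ge0.
have f2i : 0 <= \int[m2]_y f2 y by exact: integral_ge0.
rewrite -ge0_integralZl//; last 2 first.
- exact: emeasurable_funM.
- by move=> x _; apply: mule_ge0.
apply: ge0_le_integral_nonmeasurable => [x|x].
  by do 4?[apply: integral_ge0 => ? _]; do 4?apply: mule_ge0.
rewrite -/(I5 x); have {}I50 : 0 <= I5 x by exact: I50.
rewrite -ge0_integralZr//; last by apply: mule_ge0.
apply: ge0_le_integral_nonmeasurable => [y|y].
  by do 3?[apply: integral_ge0 => ? _]; do 4?apply: mule_ge0.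
apply: (@le_trans _ _ (\int[m3]_z (f1 x * f2 y * I5 x * f3 x y z))); last first.
  rewrite ge0_integralZl//; last by do 2?apply: mule_ge0.
  have -> : f2 y * (f1 x * I5 x) = f1 x * f2 y * I5 x * 1.
    by rewrite mule1 muleA (muleC (f2 y)).
  by apply: lee_wpmul2l; [do 2?apply: mule_ge0|exact: f3_le1].
apply: ge0_le_integral_nonmeasurable => [z|z].
  by do 2?[apply: integral_ge0 => ? _]; do 4?apply: mule_ge0.
have K0 : 0 <= f1 x * f2 y * I5 x * f3 x y z by do 3?apply: mule_ge0.
apply: (@le_trans _ _
  (\int[m4]_t (f1 x * f2 y * I5 x * f3 x y z * f4 y z t))); last first.
  rewrite ge0_integralZl// -[leRHS]mule1; apply: lee_wpmul2l => //.
apply: ge0_le_integral_nonmeasurable => [t|t].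
  by apply: integral_ge0 => ? _; do 4?apply: mule_ge0.
rewrite (eq_integral (fun s => f1 x * f2 y * f3 x y z * f4 y z t * f5 x s)).
  rewrite ge0_integralZl//; last by do 3?apply: mule_ge0.
  by rewrite -/(I5 x) -!muleA (muleCA (I5 x)) (muleC (I5 x)).
by move=> s _; rewrite !muleA.
Qed.
End Chain.

(** * Gaussian tails *)

Section GaussianTail.
Variable R : realType.
Implicit Types (s m : R) (n : nat).

(** The thresholds are natural numbers so that almost everywhere statements, one for each n, can be
    merged. *)
Definition gauss_tail s n m : R := fine (normal_prob m s `[n%:R, +oo[).

Lemma gauss_tailE s n m :
  ((gauss_tail s n m)%:E = \int[lebesgue_measure]_(y in `[n%:R, +oo[)
    (normal_pdf m s y)%:E)%E.
Proof. by rewrite /gauss_tail fineK// fin_num_measure. Qed.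

Lemma gauss_tail_ge0 s n m : 0 <= gauss_tail s n m.
Proof. by rewrite fine_ge0. Qed.

Lemma normal_pdf_gt0 s m y : s != 0 -> 0 < normal_pdf m s y.
Proof.
by move=> s0; rewrite normal_pdfE// mulr_gt0 ?expR_gt0 ?normal_peak_gt0.
Qed.

(** The density is positive, so a vanishing tail would put a half-line of infinite length inside a
    null set. *)
Lemma gauss_tail_gt0 s n m : s != 0 -> 0 < gauss_tail s n m.
Proof.
move=> s0; rewrite lt_neqAle gauss_tail_ge0 andbT eq_sym; apply/eqP => t0.
set D : set (measurableTypeR R) := [set` `[n%:R, +oo[].
have mD : measurable D by exact: measurable_itv.
have mf : measurable_fun D (EFin \o normal_pdf m s).
  by apply/measurable_funTS/measurable_EFinP; exact: measurable_normal_pdf.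
have : (\int[lebesgue_measure]_(y in D) `|(normal_pdf m s y)%:E| = 0)%E.
  transitivity (gauss_tail s n m)%:E; last by rewrite t0.
  rewrite gauss_tailE; apply: eq_integral => y _.
  by rewrite gee0_abs// lee_fin normal_pdf_ge0.
move/(ae_eq_integral_abs _ mD mf).1 => -[N [mN N0 sN]].
have : (lebesgue_measure D <= lebesgue_measure N)%E.
  apply: le_measure; rewrite ?inE// => y yn; apply: sN => /= /(_ yn) [].
  by apply/eqP; rewrite gt_eqF// normal_pdf_gt0.
by rewrite N0 lebesgue_measure_itv/= ltry.
Qed.

Lemma measurable_normal_prob s (D : set (measurableTypeR R)) : s != 0 ->
  measurable D -> measurable_fun setT (fun m => normal_prob m s D).
Proof.
move=> s0 mD.
pose f := fun p : measurableTypeR R * measurableTypeR R =>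
  (normal_pdf p.1 s p.2 * \1_D p.2)%:E.
have -> : (fun m => normal_prob m s D) = fubini_F lebesgue_measure f.
  apply/funext => m; rewrite /fubini_F /normal_prob [LHS]integral_mkcond.
  by apply: eq_integral => y _; rewrite epatch_indic /f EFinM.
apply: measurable_fun_fubini_tonelli_F => [|p]; last first.
  by rewrite lee_fin mulr_ge0// normal_pdf_ge0.
apply/measurable_EFinP; apply: measurable_funM; last first.
  by apply: measurableT_comp => //; exact: measurable_indic.
under eq_fun do rewrite normal_pdfE//.
apply: measurable_funM => //; apply: measurableT_comp => //.
apply: measurable_funM => //; apply: measurableT_comp => //.
by apply: measurable_funX; exact: measurable_funB.
Qed.

Lemma measurable_gauss_tail s n : s != 0 -> measurable_fun setT (gauss_tail s n).
Proof.
move=> s0; apply: measurableT_comp => //.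
by apply: measurable_normal_prob => //; exact: measurable_itv.
Qed.

(** The ratio of the densities at y is exp x, where x = (2 y (m' - m) + m^2 - m'^2) / (2 s^2). The
    number [b] is the value of y at which x = C; beyond it exp x >= 1 + x >= C, and this is
    integrated over the half-line. *)
Lemma gauss_tail_dominates s m m' C : s != 0 -> m < m' ->
  exists N, forall n, (N <= n)%N -> C * gauss_tail s n m <= gauss_tail s n m'.
Proof.
move=> s0 mm'; pose b := (C * (s ^+ 2 *+ 2) + m' ^+ 2 - m ^+ 2) / ((m' - m) *+ 2).
exists (Num.bound b) => n bn.
have bnR : b < n%:R.
  by rewrite (lt_le_trans (unstable.ltr_bound b))// ler_nat.
set D : set (measurableTypeR R) := [set` `[n%:R, +oo[].
have mD : measurable D by exact: measurable_itv.
have [C0|C0] := leP C 0.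
  by rewrite (le_trans (_ : _ <= 0))// ?gauss_tail_ge0// mulr_le0_ge0// gauss_tail_ge0.
have mpdf x : measurable_fun D (EFin \o normal_pdf x s).
  by apply/measurable_funTS/measurable_EFinP; exact: measurable_normal_pdf.
rewrite -lee_fin EFinM !gauss_tailE -ge0_integralZl_EFin ?(ltW C0)//; last 2 first.
- by move=> y _; rewrite lee_fin normal_pdf_ge0.
- exact: mpdf.
apply: ge0_le_integral => //.
- by move=> y _; rewrite mule_ge0 ?lee_fin ?normal_pdf_ge0 ?(ltW C0).
- by apply: measurable_funeM; exact: mpdf.
- exact: mpdf.
- move=> y /=; rewrite in_itv/= andbT => ny.
  rewrite -EFinM lee_fin !normal_pdfE// mulrCA ler_pM2l ?normal_peak_gt0// /normal_fun.
  have s2 : 0 < s ^+ 2 *+ 2 by rewrite pmulrn_lgt0// exprn_even_gt0.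
  have -> : - (y - m') ^+ 2 / (s ^+ 2 *+ 2) =
     (y * (m' - m) *+ 2 + m ^+ 2 - m' ^+ 2) / (s ^+ 2 *+ 2)
       + - (y - m) ^+ 2 / (s ^+ 2 *+ 2) by rewrite -mulrDl; congr (_ / _); ring.
  rewrite expRD ler_wpM2r ?expR_ge0//.
  set x := (X in expR X); apply: le_trans (expR_ge1Dx x).
  suff : C <= x by lra.
  rewrite /x ler_pdivlMr//.
  have : b < y by exact: lt_le_trans ny.
  rewrite /b ltr_pdivrMr ?pmulrn_lgt0 ?subr_gt0//.
  by rewrite mulrnAr; lra.
Qed.

Lemma gauss_tail_inj s m m' : s != 0 ->
  (forall n, gauss_tail s n m = gauss_tail s n m') -> m = m'.
Proof.
move=> s0; wlog mm' : m m' / m < m' => [H e|e].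
  have [lt|gt|//] := ltgtP m m'; first exact: H lt e.
  by apply: esym; exact: H gt (fun n => esym (e n)).
have [N /(_ N (leqnn N))] := gauss_tail_dominates 2 s0 mm'.
rewrite e; move: (gauss_tail_gt0 N m' s0).
by move: (gauss_tail s N m') => t; lra.
Qed.

(** Suppose m < m'. The tail of the second mixture is at least [w] times the tail with mean m' +
    max(0, c), [w] being the weight of such a component; the first is eventually at most the tail
    with mean M = m + max(0, c). Domination with factor 2 / w makes the second at least twice that
    bound, so the two differ. Once m = m', the mixtures differ by (p - p') times the difference of
    the component tails. *)
Lemma gauss_mixture_inj s p p' m m' c : s != 0 -> 0 < p < 1 -> 0 < p' < 1 ->
  (forall n, p * gauss_tail s n (m + c) + (1 - p) * gauss_tail s n m =
     p' * gauss_tail s n (m' + c) + (1 - p') * gauss_tail s n m') ->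
  m = m' /\ (p = p' \/ c = 0).
Proof.
move=> s0 p01 p'01 e.
have mm' : m = m'.
  wlog mm' : m m' p p' p01 p'01 e / m < m' => [H|].
    have [lt|gt|//] := ltgtP m m'; first exact: (H m m' p p' p01 p'01 e lt).
    by apply: esym; exact: (H m' m p' p p'01 p01 (fun n => esym (e n)) gt).
  have [w w0 we] : exists2 w, 0 < w & forall n,
      w * gauss_tail s n (m' + Num.max 0 c) <=
      p' * gauss_tail s n (m' + c) + (1 - p') * gauss_tail s n m'.
    have [c0|c0] := leP 0 c.
      exists p'; first by case/andP: p'01.
      by move=> n; rewrite lerDl mulr_ge0 ?gauss_tail_ge0//; lra.
    exists (1 - p'); first lra.
    by move=> n; rewrite addr0 lerDr mulr_ge0 ?gauss_tail_ge0//; lra.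
  (* The component with the larger mean dominates the tail of a mixture. *)
  set M := m + Num.max 0 c.
  have [N leM] : exists N, forall n, (N <= n)%N ->
      gauss_tail s n m <= gauss_tail s n M /\
      gauss_tail s n (m + c) <= gauss_tail s n M.
    have [c0|c0|c0] := ltgtP 0 c.
    - have [N dom] : exists N, forall n, (N <= n)%N ->
          1 * gauss_tail s n m <= gauss_tail s n (m + c).
        by apply: gauss_tail_dominates; rewrite // ltrDl.
      exists N => n /dom; rewrite /M (max_idPr (ltW c0)) mul1r => le; split;
        [exact: le|exact: lexx].
    - have [N dom] : exists N, forall n, (N <= n)%N ->
          1 * gauss_tail s n (m + c) <= gauss_tail s n m.
        by apply: gauss_tail_dominates; rewrite // gtrDl.
      exists N => n /dom; rewrite /M (max_idPl (ltW c0)) mul1r addr0 => le; split;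
        [exact: lexx|exact: le].
    - by exists 0%N => n _; rewrite /M -c0 maxxx addr0.
  have [N' dom] : exists N, forall n, (N <= n)%N ->
      2 / w * gauss_tail s n M <= gauss_tail s n (m' + Num.max 0 c).
    by apply: gauss_tail_dominates; rewrite // ltrD2r.
  have [le1 le2] := leM _ (leq_maxl N N').
  have := dom _ (leq_maxr N N'); have := we (maxn N N').
  rewrite -e; move: le1 le2 (gauss_tail_gt0 (maxn N N') M s0).
  move: (gauss_tail _ _ m) (gauss_tail _ _ M) (gauss_tail _ _ (m + c))
    (gauss_tail _ _ (m' + Num.max 0 c)) => t1 t2 t3 t4 le1 le3 t20 le4.
  rewrite mulrAC ler_pdivrMr// => le5.
  suff : p * t3 + (1 - p) * t1 <= t2 by lra.
  have : p * t3 <= p * t2 /\ (1 - p) * t1 <= (1 - p) * t2.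
    by split; rewrite ler_wpM2l//; lra.
  by lra.
split => //; subst m'.
have [->|c0] := eqVneq c 0; [by right|left].
apply/eqP/negPn/negP => pp'.
suff /(gauss_tail_inj s0)/eqP : forall n, gauss_tail s n (m + c) = gauss_tail s n m.
  by rewrite -subr_eq0 addrAC subrr add0r (negbTE c0).
move=> n; have := e n => en.
move: en; move: (gauss_tail s n (m + c)) (gauss_tail s n m) => x y en.
have /eqP : (p - p') * (x - y) = 0 by lra.
by rewrite mulf_eq0 !subr_eq0 (negbTE pp') => /eqP.
Qed.

End GaussianTail.

(** * The factorization over the DAG *)

Section SigmaOf.
Context d (T : measurableType d) (R : realType) (I : Type) (X : I -> T -> R).
Implicit Types D : set I.

Let gen D : set (set T) :=
  \bigcup_(i in D) preimage_set_system setT (X i) (@measurable _ (measurableTypeR R)).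

(** A copy of [T] carrying the generated sigma-algebra as its measurable structure: membership in
    [sigma_of X D] becomes measurability of a map, which composition and pairing preserve. *)
Definition sigma_of_type D : Type := g_sigma_algebraType (gen D).
HB.instance Definition _ D := Measurable.on (sigma_of_type D).

Lemma measurable_coord_sigma_of D i : D i ->
  measurable_fun setT (X i : sigma_of_type D -> measurableTypeR R).
Proof.
move=> Di _ B mB; apply: sub_sigma_algebra; exists i => //.
by exists B.
Qed.

Lemma sigma_of_preimage D d' (T' : measurableType d') (p : T -> T') B :
  measurable_fun setT (p : sigma_of_type D -> T') ->
  measurable B -> sigma_of X D (p @^-1` B).
Proof. by move=> mp mB; rewrite -[X in sigma_of _ _ X]setTI; exact: mp. Qed.

End SigmaOf.

Section CondDensity.
Context d (T : measurableType d) (R : realType) (P : probability T R).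
Local Open Scope ereal_scope.

(** With the whole line as the set of values of Z, the defining identity says that the total mass of
    [k] integrates to P(E) over every E, so it is 1 almost surely. The map [p] reads off the
    conditioning variables and [s] extends their values to a point of [T], so the exceptional set is
    one of parent values. *)
Lemma cond_density_norm (I : Type) (X : I -> T -> R)
    (nu : {sigma_finite_measure set (measurableTypeR R) -> \bar R})
    (Z : T -> R) (D : set I) (k : R -> T -> R) d' (T' : measurableType d')
    (p : {mfun T >-> T'}) (s : T' -> T) :
  is_cond_density P X nu Z D k ->
  measurable_fun setT (p : sigma_of_type X D -> T') -> measurable_fun setT s ->
  (forall z w, k z w = k z (s (p w))) ->
  P (p @^-1` [set t | \int[nu]_z (k z (s t))%:E != 1]) = 0.
Proof.
move=> [mk k0 _ kE] mp ms ks; pose psi t := \int[nu]_z (k z (s t))%:E.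
have mf : measurable_fun setT
    (fun q : T' * measurableTypeR R => (k q.2 (s q.1))%:E : \bar R).
  apply/measurable_EFinP.
  have -> : (fun q : T' * measurableTypeR R => k q.2 (s q.1)) =
    (fun q => k q.1 q.2) \o (fun q => (q.2, s q.1)) by [].
  apply: measurableT_comp => //; apply: measurable_fun_pair => //.
  exact: measurableT_comp.
have mpsi : measurable_fun setT psi.
  by apply: (measurable_fun_fubini_tonelli_F _ mf) => q; rewrite lee_fin.
have : ae_eq (distribution P p) setT (cst 1) psi.
  apply: integral_ae_eq => //.
    exact: finite_measure_integrable_cst.
  move=> E _ mE.
  rewrite integral_cst// mul1e.
  rewrite ge0_integral_pushforward//; last 2 first.
  - exact: measurable_funTS.
  - by move=> t _; apply: integral_ge0 => z _; rewrite lee_fin.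
  have := kE setT _ measurableT (sigma_of_preimage mp mE).
  rewrite preimage_setT setTI => PE.
  rewrite [LHS]PE; apply: eq_integral => w _; apply: eq_integral => z _.
  by rewrite /= -ks.
have mS : measurable [set t | psi t != 1].
  have -> : [set t | psi t != 1] = ~` (psi @^-1` [set 1]).
    by apply/seteqP; split=> t /= /eqP.
  by apply: measurableC; rewrite -[X in measurable X]setTI; exact: mpsi.
move=> ae1; apply/(negligibleP (distribution P p) mS).
apply: negligibleS ae1 => t /= /eqP pt1 H.
by apply: pt1; rewrite -H.
Qed.
End CondDensity.

Section Factors.
Variable R : realType.
Local Notation mR := (measurableTypeR R).
Local Notation leb := (@lebesgue_measure R).
Variables (P : probability (wspace R) R)
  (nuU : {sigma_finite_measure set mR -> \bar R}).
Variables (kU kA0 : mR -> R) (kL kA1 : mR * mR * mR -> R) (kY : mR * mR -> R).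
Local Open Scope ereal_scope.

Definition dag_density (w : wspace R) : R :=
  let: (u, a0, l, a1, y) := w in
  (kU u * (kA0 a0 * (kL (u, a0, l) * (kA1 (a0, l, a1) * kY (u, y)))))%R.

Definition proj_UA0 (w : wspace R) : mR * mR := (wcoord wU w, wcoord wA0 w).
Definition proj_A0L (w : wspace R) : mR * mR := (wcoord wA0 w, wcoord wL w).
Definition proj_A0LA1 (w : wspace R) : mR * mR * mR :=
  (wcoord wA0 w, wcoord wL w, wcoord wA1 w).

(* Conditional densities are versions, hence normalized only almost surely: see
   the last three fields. *)
Record dag_factors : Prop := {
  mkU : measurable_fun setT kU;
  mkA0 : measurable_fun setT kA0;
  mkL : measurable_fun setT kL;
  mkA1 : measurable_fun setT kA1;
  mkY : measurable_fun setT kY;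
  kU_ge0 : forall u, (0 <= kU u)%R;
  kA0_ge0 : forall a0, (0 <= kA0 a0)%R;
  kL_ge0 : forall t, (0 <= kL t)%R;
  kA1_ge0 : forall t, (0 <= kA1 t)%R;
  kY_ge0 : forall t, (0 <= kY t)%R;
  dag_densityP : forall G, measurable G ->
    P G = \int[wmeasure nuU]_(w in G) (dag_density w)%:E;
  kU_total : \int[nuU]_u (kU u)%:E = 1;
  kA0_density : forall B : set mR, measurable B ->
    P (wcoord wA0 @^-1` B) = \int[leb]_(a0 in B) (kA0 a0)%:E;
  L_01 : forall D : set mR, measurable D -> counting01 R D = 0 ->
    P (wcoord wL @^-1` D) = 0;
  kL_norm : P (proj_UA0 @^-1`
    [set t | \int[counting01 R]_l (kL (t, l))%:E != 1]) = 0;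
  kA1_norm : P (proj_A0L @^-1` [set t | \int[leb]_a1 (kA1 (t, a1))%:E != 1]) = 0;
  kY_norm : P (wcoord wU @^-1` [set u | \int[leb]_y (kY (u, y))%:E != 1]) = 0
}.

End Factors.

Lemma measurable_proj (R : realType) :
  [/\ measurable_fun setT (@proj_UA0 R), measurable_fun setT (@proj_A0L R)
    & measurable_fun setT (@proj_A0LA1 R)].
Proof.
by split; do ?[apply: measurable_fun_pair]; exact: measurable_wcoord.
Qed.

HB.instance Definition _ (R : realType) (i : wvar) :=
  isMeasurableFun.Build _ _ (wspace R) R (@wcoord R i) (@measurable_wcoord R i).
HB.instance Definition _ (R : realType) :=
  isMeasurableFun.Build _ _ (wspace R) _ (@proj_UA0 R)
    (let: And3 m _ _ := measurable_proj R in m).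
HB.instance Definition _ (R : realType) :=
  isMeasurableFun.Build _ _ (wspace R) _ (@proj_A0L R)
    (let: And3 _ m _ := measurable_proj R in m).
HB.instance Definition _ (R : realType) :=
  isMeasurableFun.Build _ _ (wspace R) _ (@proj_A0LA1 R)
    (let: And3 _ _ m := measurable_proj R in m).

Lemma represented_factors (R : realType) (P : probability (wspace R) R) :
  represented_DAG1b P ->
  exists nuU kU kA0 kL kA1 kY, dag_factors P nuU kU kA0 kL kA1 kY.
Proof.
move=> [nuU _ [k [kcond [mq q0 Pq]]]]; exists nuU.
pose mR := measurableTypeR R.
(* Each kernel depends on the parents only, so the remaining coordinates are frozen at 0. *)
exists (fun u : mR => k wU u (0, 0, 0, 0, 0)).
exists (fun a0 : mR => k wA0 a0 (0, 0, 0, 0, 0)).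
exists (fun t : mR * mR * mR => k wL t.2 (t.1.1, t.1.2, 0, 0, 0)).
exists (fun t : mR * mR * mR => k wA1 t.2 (0, t.1.1, t.1.2, 0, 0)).
exists (fun t : mR * mR => k wY t.2 (t.1, 0, 0, 0, 0)).
have mk i d (T : measurableType d) (f : T -> mR) (g : T -> wspace R) :
    measurable_fun setT f -> measurable_fun setT g ->
    measurable_fun setT (fun t => k i (f t) (g t)).
  move=> mf mg; have [mki _ _ _] := kcond i.
  exact: (measurableT_comp mki (measurable_fun_pair mf mg)).
have k0 i z w : 0 <= k i z w by have [] := kcond i.
have kdep i z w w' : (forall j, DAG1b j i -> wcoord j w = wcoord j w') ->
    k i z w = k i z w'.
  move=> H; have [_ _ + _] := kcond i; apply => j /=.
  by rewrite inE; exact: H.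
have sT D : sigma_of wcoord D [set: wspace R].
  exact: (@measurableT _ (sigma_of_type wcoord D)).
have kint i A : measurable A ->
    P (wcoord i @^-1` A) = (\int[P]_w \int[wref nuU i]_(z in A) (k i z w)%:E)%E.
  move=> mA; have [_ _ _ kE] := kcond i.
  by rewrite -(kE _ _ mA (sT _)) setIT.
have [mUA0 mA0L _] := measurable_proj R.
have mc i : measurable_fun setT (@wcoord R i) := measurable_wcoord i.
constructor=> [|||||?|?|?|?|?|||||||]; try exact: k0.
- exact: mk.
- exact: mk.
- by apply: mk => //; do 4?apply: measurable_fun_pair => //; exact: measurableT_comp.
- by apply: mk => //; do 4?apply: measurable_fun_pair => //; exact: measurableT_comp.
- by apply: mk => //; do 4?apply: measurable_fun_pair => //.
- move=> G mG; rewrite (Pq _ mG); apply: eq_integral => w _; congr EFin.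
  rewrite (bigD1 wU)//= (bigD1 wA0)//= (bigD1 wL)//= (bigD1 wA1)//= (bigD1 wY)//=.
  rewrite big1 ?mulr1; last by case.
  case: w => [[[[u a0] l] a1] y] /=.
  by congr (_ * (_ * (_ * (_ * _)))); apply: kdep; case.
- transitivity (P (wcoord wU @^-1` setT)); last by rewrite preimage_setT probability_setT.
  rewrite (kint _ _ measurableT).
  transitivity (\int[P]_w cst (\int[nuU]_u (k wU u (0, 0, 0, 0, 0))%:E) w)%E.
    by rewrite integral_cst//= probability_setT mule1.
  by apply: eq_integral => w _; apply: eq_integral => u _; congr EFin; apply: kdep; case.
- move=> B mB.
  rewrite (kint _ _ mB).
  transitivity (\int[P]_w cst 
    (\int[lebesgue_measure]_(u in B) (k wA0 u (0, 0, 0, 0, 0))%:E) w)%E.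
    by apply: eq_integral => w _; apply: eq_integral => u _; congr EFin; apply: kdep; case.
  by rewrite integral_cst//= probability_setT mule1.
- move=> D mD D0; rewrite (kint _ _ mD) integral0_eq// => w _.
  apply: null_set_integral => //.
  by apply/measurable_funTS/measurable_EFinP; exact: mk.
- apply: (@cond_density_norm _ _ _ P _ _ (counting01 R) _ _ _ _ _ (@proj_UA0 R)
    (fun t => (t.1, t.2, 0, 0, 0)) (kcond wL)).
  + by apply: measurable_fun_pair; apply: measurable_coord_sigma_of; rewrite /= inE.
  + by do 4?apply: measurable_fun_pair => //.
  + by move=> z w; apply: kdep; case.
- apply: (@cond_density_norm _ _ _ P _ _ lebesgue_measure _ _ _ _ _ (@proj_A0L R)
    (fun t => (0, t.1, t.2, 0, 0)) (kcond wA1)).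
  + by apply: measurable_fun_pair; apply: measurable_coord_sigma_of; rewrite /= inE.
  + by do 4?apply: measurable_fun_pair => //.
  + by move=> z w; apply: kdep; case.
- apply: (@cond_density_norm _ _ _ P _ _ lebesgue_measure _ _ _ _ _ (@wcoord R wU)
    (fun t => (t, 0, 0, 0, 0)) (kcond wY)).
  + by apply: measurable_coord_sigma_of; rewrite /= inE.
  + by do 4?apply: measurable_fun_pair => //.
  + by move=> z w; apply: kdep; case.
Qed.

Lemma indic_preimage (T T' : Type) (R : realType) (f : T -> T') (A : set T') x :
  \1_(f @^-1` A) x = \1_A (f x) :> R.
Proof. by rewrite !indicE; congr (nat_of_bool _)%:R; apply: asbool_equiv_eq. Qed.

Lemma measurable_dag_density (R : realType) P nuU kU kA0 kL kA1 kY :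
  @dag_factors R P nuU kU kA0 kL kA1 kY ->
  measurable_fun setT (dag_density kU kA0 kL kA1 kY).
Proof.
move=> F; have mc i := @measurable_wcoord R i.
have -> : dag_density kU kA0 kL kA1 kY = fun w =>
    kU (wcoord wU w) * (kA0 (wcoord wA0 w) *
      (kL (wcoord wU w, wcoord wA0 w, wcoord wL w) *
      (kA1 (wcoord wA0 w, wcoord wL w, wcoord wA1 w) *
       kY (wcoord wU w, wcoord wY w)))).
  by apply/funext => -[[[[u a0] l] a1] y].
apply: measurable_funM; first exact: measurableT_comp (mkU F) (mc _).
apply: measurable_funM; first exact: measurableT_comp (mkA0 F) (mc _).
apply: measurable_funM.
  apply: (measurableT_comp (mkL F)).
  by do 2?apply: measurable_fun_pair; exact: mc.
apply: measurable_funM.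
  apply: (measurableT_comp (mkA1 F)).
  by do 2?apply: measurable_fun_pair; exact: mc.
apply: (measurableT_comp (mkY F)).
by apply: measurable_fun_pair; exact: mc.
Qed.

Lemma dag_density_ge0 (R : realType) P nuU kU kA0 kL kA1 kY w :
  @dag_factors R P nuU kU kA0 kL kA1 kY -> 0 <= dag_density kU kA0 kL kA1 kY w.
Proof.
by case=> *; case: w => [[[[u a0] l] a1] y]; rewrite /dag_density; do 4?apply: mulr_ge0.
Qed.

(** * Independence of A0 and Y from the factorization *)

Section Indep.
Variable R : realType.
Local Notation mR := (measurableTypeR R).
Local Notation leb := (@lebesgue_measure R).
Variables (P : probability (wspace R) R)
  (nuU : {sigma_finite_measure set mR -> \bar R}).
Variables (kU kA0 : mR -> R) (kL kA1 : mR * mR * mR -> R) (kY : mR * mR -> R).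
Hypothesis F : dag_factors P nuU kU kA0 kL kA1 kY.
Local Open Scope ereal_scope.

Let SY : set mR := [set u | \int[leb]_y (kY (u, y))%:E = 1].
Let SL : set (mR * mR) := [set t | \int[counting01 R]_l (kL (t, l))%:E = 1].
Let SA1 : set (mR * mR) := [set t | \int[leb]_a1 (kA1 (t, a1))%:E = 1].

Let integral_kernel_measurable d (T : measurableType d)
    (nu : {sigma_finite_measure set mR -> \bar R}) (k : T * mR -> R) :
  measurable_fun setT k -> (forall t, 0 <= k t)%R ->
  measurable_fun setT (fun t => \int[nu]_z (k (t, z))%:E) /\
  measurable [set t | \int[nu]_z (k (t, z))%:E = 1].
Proof.
move=> mk k0.
have mI : measurable_fun setT (fun t => \int[nu]_z (k (t, z))%:E).
  apply: (measurable_fun_fubini_tonelli_F (EFin \o k)).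
    exact/measurable_EFinP.
  by move=> t; rewrite lee_fin.
split => //; rewrite -[X in measurable X]setTI.
exact: (mI measurableT [set 1] (emeasurable_set1 1)).
Qed.

Let mSY : measurable SY.
Proof. exact: (integral_kernel_measurable leb (mkY F) (kY_ge0 F)).2. Qed.
Let mSL : measurable SL.
Proof. exact: (integral_kernel_measurable (counting01 R) (mkL F) (kL_ge0 F)).2. Qed.
Let mSA1 : measurable SA1.
Proof. exact: (integral_kernel_measurable leb (mkA1 F) (kA1_ge0 F)).2. Qed.

Let kY_in (A : set mR) (t : mR * mR) : R := (kY t * (\1_SY t.1 * \1_A t.2))%R.

Let mkY_in A : measurable A -> measurable_fun setT (kY_in A).
Proof.
move=> mA; apply: measurable_funM; first exact: mkY F.
apply: measurable_funM.
- exact: (measurableT_comp (measurable_indic mSY) measurable_fst).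
- exact: (measurableT_comp (measurable_indic mA) measurable_snd).
Qed.

(** The probability of Y in A as computed from [kU] and [kY] alone. In [kY_in] the values u at which
    [kY] is not normalized are dropped, which keeps the total mass at most 1. *)
Definition latent_mass (A : set mR) : \bar R :=
  \int[nuU]_u ((kU u)%:E * \int[leb]_y (kY_in A (u, y))%:E).

(* On [trim A B] the kernels are normalized, so integrating out L and A1 bounds its
   probability by a product.  The bounds for A and for its complement add up to
   at most P(A0 in B), so both are equalities. *)
Let trim (A B : set mR) : set (wspace R) :=
  (wcoord wA0 @^-1` B `&` wcoord wY @^-1` A) `&`
  (wcoord wU @^-1` SY `&` (@proj_UA0 R @^-1` SL `&` @proj_A0L R @^-1` SA1)).

Let mtrim A B : measurable A -> measurable B -> measurable (trim A B).
Proof.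
move=> mA mB; have [mUA0 mA0L _] := measurable_proj R.
have mc i := @measurable_wcoord R i.
by do ?apply: measurableI; rewrite -[X in measurable X]setTI;
  do ?[exact: mc|exact: mUA0|exact: mA0L].
Qed.

Let P_trim_le A B : measurable A -> measurable B ->
  P (trim A B) <= P (wcoord wA0 @^-1` B) * latent_mass A.
Proof.
move=> mA mB; rewrite (dag_densityP F); last exact: mtrim.
pose f3 u a0 l := (kL (u, a0, l) * \1_SL (u, a0))%:E.
pose f4 a0 l a1 := (kA1 (a0, l, a1) * \1_SA1 (a0, l))%:E.
(* The boolean [b] tells whether the kernel is normalized at the given parent values; if it is not,
   the indicator annihilates it. *)
have kernel_le1 d (T : measurableType d) (nu : {measure set T -> \bar R})
    (k : T -> R) (b : bool) : measurable_fun setT k -> (forall t, 0 <= k t)%R ->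
    (b -> \int[nu]_t (k t)%:E = 1) -> \int[nu]_t (k t * b%:R)%:E <= 1.
  move=> mk k0; case: b => [/(_ isT) <-|_].
    by apply: ge0_le_integral_nonmeasurable => t; rewrite lee_fin mulr1.
  by rewrite integral0_eq// => t _; rewrite mulr0.
have mden : measurable_fun setT (EFin \o dag_density kU kA0 kL kA1 kY).
  by apply/measurable_EFinP; exact: measurable_dag_density F.
have mpatch : measurable_fun setT
    ((EFin \o dag_density kU kA0 kL kA1 kY) \_ (trim A B)).
  by apply: (measurable_restrictT _ (mtrim mA mB)).1; exact: measurable_funTS.
rewrite integral_mkcond ge0_integral_wmeasure; last 2 first.
- exact: mpatch.
- by move=> w; apply: erestrict_ge0 => w' _; rewrite lee_fin (dag_density_ge0 _ F).
have eB : \int[leb]_a0 (kA0 a0 * \1_B a0)%:E = P (wcoord wA0 @^-1` B).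
  rewrite (kA0_density F mB) [RHS]integral_mkcond.
  by apply: eq_integral => a0 _; rewrite epatch_indic EFinM.
rewrite -eB.
have kY0 u y : 0 <= (kY_in A (u, y))%:E by rewrite lee_fin !mulr_ge0// (kY_ge0 F).
have := @integral_chain_le _ _ _ _ _ _ _ _ _ _ R nuU leb
   (counting01 R) leb leb (EFin \o kU) (fun a0 => (kA0 a0 * \1_B a0)%:E)
   f3 f4 (fun u y => (kY_in A (u, y))%:E).
move=> chain; apply: le_trans (chain _ _ _ _ _ _ _ _ _ _ _ _ _) => {chain}.
- rewrite le_eqVlt; apply/orP; left; apply/eqP.
  apply: eq_integral => u _; apply: eq_integral => a0 _.
  apply: eq_integral => l _; apply: eq_integral => a1 _; apply: eq_integral => y _.
  rewrite epatch_indic /trim !indicI /= !indic_preimage /=.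
  rewrite -!EFinM; congr EFin.
  rewrite /kY_in /=.
  ring.
- by move=> u; rewrite lee_fin (kU_ge0 F).
- by move=> a0; rewrite lee_fin mulr_ge0// (kA0_ge0 F).
- by move=> u a0 l; rewrite lee_fin mulr_ge0// (kL_ge0 F).
- by move=> a0 l a1; rewrite lee_fin mulr_ge0// (kA1_ge0 F).
- exact: kY0.
- by apply/measurable_EFinP; exact: mkU F.
- apply/measurable_EFinP; apply: measurable_funM; first exact: mkA0 F.
  exact: measurable_indic.
- move=> u a0; apply/measurable_EFinP; apply: measurable_funM => //.
  exact: measurable_fun_pair2 (mkL F).
- move=> a0 l; apply/measurable_EFinP; apply: measurable_funM => //.
  exact: measurable_fun_pair2 (mkA1 F).
- move=> u; apply/measurable_EFinP.
  exact: measurable_fun_pair2 (mkY_in mA).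
- by apply: (integral_kernel_measurable leb (mkY_in mA) _).1 => -[u y]; rewrite -lee_fin.
- move=> u a0; rewrite /f3 indicE; apply: kernel_le1.
  + exact: measurable_fun_pair2 (mkL F).
  + by move=> l; exact: kL_ge0 F _.
  + by rewrite inE.
- move=> a0 l; rewrite /f4 indicE; apply: kernel_le1.
  + exact: measurable_fun_pair2 (mkA1 F).
  + by move=> a1; exact: kA1_ge0 F _.
  + by rewrite inE.
Qed.

(** Trimming removes only points of three null events, those where the kernel of Y, of L or of A1
    fails to be normalized. *)
Let P_trim A B : measurable A -> measurable B ->
  P (wcoord wA0 @^-1` B `&` wcoord wY @^-1` A) <= P (trim A B).
Proof.
move=> mA mB; pose G := wcoord wA0 @^-1` B `&` wcoord wY @^-1` A.
have [mUA0 mA0L _] := measurable_proj R.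
have mpre d (T : measurableType d) (f : wspace R -> T) (S : set T) :
    measurable_fun setT f -> measurable S -> measurable (f @^-1` S).
  by move=> mf mS; rewrite -[X in measurable X]setTI; exact: mf.
have mc i := @measurable_wcoord R i.
pose N := wcoord wU @^-1` (~` SY) `|` (@proj_UA0 R @^-1` (~` SL) `|`
  @proj_A0L R @^-1` (~` SA1)).
have mN1 : measurable (wcoord wU @^-1` (~` SY)) by apply: mpre => //; exact: measurableC.
have mN2 : measurable (@proj_UA0 R @^-1` (~` SL)).
  by apply: mpre => //; exact: measurableC.
have mN3 : measurable (@proj_A0L R @^-1` (~` SA1)).
  by apply: mpre => //; exact: measurableC.
have setne d (T : measurableType d) (f : T -> \bar R) :
    ~` [set t | f t = 1] = [set t | f t != 1].
  by apply/seteqP; split=> t /= /eqP.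
have mN : measurable N by apply: measurableU => //; exact: measurableU.
have PN : P N = 0.
  apply/negligibleP => //; apply: negligibleU; last apply: negligibleU.
  - by apply/negligibleP => //; rewrite setne; exact: kY_norm F.
  - by apply/negligibleP => //; rewrite setne; exact: kL_norm F.
  - by apply/negligibleP => //; rewrite setne; exact: kA1_norm F.
have mT := mtrim mA mB.
rewrite -[leRHS]adde0 -PN; apply: le_trans (measureU2 _ _ _) => //.
apply: le_measure; rewrite ?inE.
- by apply: measurableI; apply: mpre.
- exact: measurableU.
- move=> w Gw; apply: contrapT => /not_orP[nT nN].
  apply: nT; split=> //; split; [|split]; apply: contrapT => nS; apply: nN.
  + by left.
  + by right; left.
  + by right; right.
Qed.

Let kY_in_ge0 A t : (0 <= kY_in A t)%R.
Proof. by rewrite !mulr_ge0// (kY_ge0 F). Qed.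

Let latent_mass_ge0 A : 0 <= latent_mass A.
Proof.
apply: integral_ge0 => u _; rewrite mule_ge0 ?lee_fin ?(kU_ge0 F)//.
by apply: integral_ge0 => y _; rewrite lee_fin.
Qed.

Let latent_mass_le1 A : measurable A -> latent_mass A + latent_mass (~` A) <= 1.
Proof.
move=> mA; have mAC := measurableC mA.
have mI C : measurable C ->
    measurable_fun setT (fun u => \int[leb]_y (kY_in C (u, y))%:E).
  by move=> mC; exact: (integral_kernel_measurable leb (mkY_in mC) (kY_in_ge0 C)).1.
have mk C u : measurable C -> measurable_fun setT (fun y => (kY_in C (u, y))%:E).
  by move=> mC; apply/measurable_EFinP; exact: measurable_fun_pair2 (mkY_in mC).
have mkUE : measurable_fun setT (EFin \o kU) by apply/measurable_EFinP; exact: mkU F.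
have I0 C u : 0 <= \int[leb]_y (kY_in C (u, y))%:E.
  by apply: integral_ge0 => y _; rewrite lee_fin.
rewrite -ge0_integralD//; last 4 first.
- by move=> u _; rewrite mule_ge0// lee_fin (kU_ge0 F).
- by apply: emeasurable_funM => //; exact: mI.
- by move=> u _; rewrite mule_ge0// lee_fin (kU_ge0 F).
- by apply: emeasurable_funM => //; exact: mI.
rewrite -[leRHS](kU_total F); apply: ge0_le_integral_nonmeasurable => u.
  by rewrite adde_ge0// mule_ge0// lee_fin (kU_ge0 F).
rewrite -ge0_muleDr//.
rewrite -ge0_integralD//; last 4 first.
- by move=> y _; rewrite lee_fin.
- exact: mk.
- by move=> y _; rewrite lee_fin.
- exact: mk.
rewrite -[leRHS]mule1; apply: lee_wpmul2l; first by rewrite lee_fin (kU_ge0 F).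
have [uS|uS] := pselect (SY u).
  rewrite -[leRHS]uS; apply: ge0_le_integral_nonmeasurable => y.
    by rewrite adde_ge0// lee_fin.
  rewrite -EFinD lee_fin /kY_in /= indicE mem_set// mul1r.
  rewrite !indicE in_setC -mulrDr ler_piMr ?(kY_ge0 F)//.
  by case: (y \in A); rewrite ?mulr0 ?mulr1 ?addr0 ?add0r.
rewrite integral0_eq// => y _.
by rewrite /kY_in /= indicE memNset// !mul0r mulr0 adde0.
Qed.

Lemma latent_mass_fin A : measurable A -> latent_mass A \is a fin_num.
Proof.
move=> mA; rewrite ge0_fin_numE ?latent_mass_ge0//.
apply: le_lt_trans (ltry 1); apply: le_trans (latent_mass_le1 mA).
by rewrite leeDl.
Qed.

Lemma dag_indep_A0_Y A B : measurable A -> measurable B ->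
  P (wcoord wA0 @^-1` B `&` wcoord wY @^-1` A) =
  P (wcoord wA0 @^-1` B) * latent_mass A.
Proof.
move=> mA mB; have mAC := measurableC mA.
pose G C := wcoord wA0 @^-1` B `&` wcoord wY @^-1` C.
have le C : measurable C -> P (G C) <= P (wcoord wA0 @^-1` B) * latent_mass C.
  by move=> mC; apply: le_trans (P_trim mC mB) (P_trim_le mC mB).
have mpre i (S : set mR) : measurable S -> measurable (@wcoord R i @^-1` S).
  by move=> mS; rewrite -[X in measurable X]setTI; exact: measurable_wcoord.
have mG C : measurable C -> measurable (G C).
  by move=> mC; apply: measurableI; exact: mpre.
have PB : P (wcoord wA0 @^-1` B) = P (G A) + P (G (~` A)).
  rewrite -measureU//; [|exact: mG|exact: mG|].
    by rewrite -setIUr preimage_setC setUv setIT.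
  by rewrite /G setIACA preimage_setC setICr setI0.
apply/eqP; rewrite eq_le le//=.
have := le _ mAC; have := latent_mass_le1 mA.
have := latent_mass_fin mA; have := latent_mass_fin mAC.
have fP C : measurable C -> P (G C) \is a fin_num.
  by move=> mC; apply: fin_num_measure; exact: mG.
move: PB (fP _ mA) (fP _ mAC).
have : P (wcoord wA0 @^-1` B) \is a fin_num by apply: fin_num_measure; exact: mpre.
have : 0 <= P (wcoord wA0 @^-1` B) by [].
case: (P (wcoord _ @^-1` B)) (P (G A)) (P (G (~` A))) (latent_mass A) (latent_mass (~` A))
  => [b| |] [x| |] [y| |] [s| |] [t| |]//.
rewrite !lee_fin => b0 _ /eqP; rewrite -EFinD eqe => /eqP bxy; rewrite bxy in b0 *.
move=> _ _ _ _ st1 yt.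
(* With b = x + y, the bounds s + t <= 1 and y <= b t give b s <= b (1 - t) <= b - y = x. *)
have : ((x + y) * s <= (x + y) * (1 - t))%R by apply: ler_wpM2l; lra.
by lra.
Qed.

End Indep.

(** * Consequences of the two models *)

Lemma expit_itv (R : realType) (x : R) : 0 < expit x < 1.
Proof.
have e0 := expR_gt0 x; have e1 : 0 < 1 + expR x by lra.
by rewrite /expit divr_gt0//= ltr_pdivrMr//; lra.
Qed.

Lemma measurable_expit (R : realType) : measurable_fun setT (@expit R).
Proof.
apply: continuous_measurable_fun => x; apply: cvgM; first exact: continuous_expR.
apply: cvgV; first by rewrite gt_eqF// addr_gt0// expR_gt0.
by apply: cvgD; [exact: cvg_cst|exact: continuous_expR].
Qed.

Lemma expit_inj (R : realType) : injective (@expit R).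
Proof.
move=> x y; rewrite /expit => /eqP; have x0 := expR_gt0 x; have y0 := expR_gt0 y.
have n0 z : 1 + expR z != 0 :> R by rewrite gt_eqF// addr_gt0// expR_gt0.
rewrite eqr_div// => /eqP e; apply: expR_inj.
by move: e; rewrite !mulrDr !mulr1 (mulrC (expR y)) => /addIr.
Qed.

Section Models.
Variables (R : realType) (P : probability (wspace R) R)
  (Q : probability (vspace R) R).
Hypothesis QP : forall E, measurable E -> Q E = distribution P observed E.
Local Notation mR := (measurableTypeR R).

Lemma measurable_vcoord i : measurable_fun setT (@vcoord R i).
Proof.
have -> : vcoord i = match i with
  | vA0 => fst \o (fst \o fst) | vA1 => snd \o (fst \o fst)
  | vL => snd \o fst | vY => snd end :> (vspace R -> R).
  by apply/funext => -[[[a0 a1] l] y]; case: i.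
by case: i => //; do ?apply: measurableT_comp.
Qed.

Lemma ge0_integral_observed (g : vspace R -> \bar R) E : measurable E ->
  measurable_fun setT g -> (forall v, 0 <= g v)%E ->
  (\int[Q]_(v in E) g v = \int[P]_(w in observed @^-1` E) g (observed w))%E.
Proof.
move=> mE mg g0.
rewrite (@eq_measure_integral _ _ _ E (distribution P observed)).
  by rewrite ge0_integral_pushforward//; exact: measurable_funTS.
by move=> A mA _; exact: QP.
Qed.

Definition proj_vA0LA1 (v : vspace R) : mR * mR * mR :=
  (vcoord vA0 v, vcoord vL v, vcoord vA1 v).

Lemma M1_kernel : M1_correct Q ->
  exists theta0 theta1 theta2 theta3 s : R, s != 0 /\
  forall (A : set mR) (E : set (mR * mR * mR)), measurable A -> measurable E ->
  P (wcoord wY @^-1` A `&` @proj_A0LA1 R @^-1` E) =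
  (\int[P]_(w in @proj_A0LA1 R @^-1` E) normal_prob
    (theta0 + theta1 * wcoord wA0 w + theta2 * wcoord wL w
     + theta3 * wcoord wA1 w) s A)%E.
Proof.
move=> [t0 [t1 [t2 [t3 [s2 [s20 [_ _ _ kE]]]]]]].
have s0 : Num.sqrt s2 != 0 by rewrite gt_eqF// sqrtr_gt0.
exists t0, t1, t2, t3, (Num.sqrt s2); split => // A E mA mE.
have mc i := measurable_vcoord i.
have mp : measurable_fun setT proj_vA0LA1.
  by do 2?apply: measurable_fun_pair; exact: mc.
have mpE : measurable (proj_vA0LA1 @^-1` E).
  by rewrite -[X in measurable X]setTI; exact: mp.
have := kE A (proj_vA0LA1 @^-1` E) mA.
have sE : sigma_of vcoord [set vA0; vA1; vL] (proj_vA0LA1 @^-1` E).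
  apply: sigma_of_preimage mE; do 2?apply: measurable_fun_pair;
    apply: (@measurable_coord_sigma_of _ (vspace R) R vvar vcoord).
  - by left; left.
  - by right.
  - by left; right.
move=> /(_ sE); rewrite QP; last first.
  by apply: measurableI => //; rewrite -[X in measurable X]setTI; exact: mc.
have mg : measurable_fun setT (fun v => normal_prob (t0 + t1 * vcoord vA0 v +
    t2 * vcoord vL v + t3 * vcoord vA1 v) (Num.sqrt s2) A).
  apply: (measurableT_comp (measurable_normal_prob s0 mA)).
  by do 3?apply: measurable_funD => //; apply: measurable_funM => //; exact: mc.
by rewrite (ge0_integral_observed mpE mg)// => H; exact: H.
Qed.

Lemma M2_kernel : M2_correct Q ->
  exists gamma0 gamma1 : R, forall B : set mR, measurable B ->
  P (wcoord wL @^-1` [set 1] `&` wcoord wA0 @^-1` B) =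
  (\int[P]_(w in wcoord wA0 @^-1` B)
    (expit (gamma0 + gamma1 * wcoord wA0 w))%:E)%E.
Proof.
move=> [g0 [g1 [_ _ gE]]]; exists g0, g1 => B mB.
have mc i := measurable_vcoord i.
have mpre i (S : set mR) : measurable S -> measurable (@vcoord R i @^-1` S).
  by move=> mS; rewrite -[X in measurable X]setTI; exact: mc.
have sB : sigma_of vcoord [set vA0] (@vcoord R vA0 @^-1` B).
  apply: sigma_of_preimage mB.
  exact: (@measurable_coord_sigma_of _ (vspace R) R vvar vcoord).
have := gE _ sB; rewrite QP; last by apply: measurableI; apply: mpre.
have mg : measurable_fun setT (fun v : vspace R => (expit (g0 + g1 * vcoord vA0 v))%:E).
  apply/measurable_EFinP; apply: (measurableT_comp (@measurable_expit R)).
  by apply: measurable_funD => //; apply: measurable_funM => //; exact: mc.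
rewrite (ge0_integral_observed (mpre _ _ mB) mg) => [/esym //|v].
by rewrite lee_fin; case/andP: (expit_itv (g0 + g1 * vcoord vA0 v)) => /ltW.
Qed.

End Models.

Lemma mul_fin_inj (R : realType) (h : \bar R) (a b : R) :
  h \is a fin_num -> h != 0%E -> (a%:E * h = b%:E * h)%E -> a = b.
Proof. by case: h => [h| |]// _; rewrite eqe => h0 [/(mulIf h0)]. Qed.

(** * Vanishing of the coefficient of A1 *)

Section ThetaThree.
Variable R : realType.
Local Notation mR := (measurableTypeR R).
Local Notation leb := (@lebesgue_measure R).
Variables (P : probability (wspace R) R)
  (nuU : {sigma_finite_measure set mR -> \bar R}).
Variables (kU kA0 : mR -> R) (kL kA1 : mR * mR * mR -> R) (kY : mR * mR -> R).
Hypothesis F : dag_factors P nuU kU kA0 kL kA1 kY.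
Local Open Scope ereal_scope.

Let lam2 : {sigma_finite_measure set (mR * mR)%type -> \bar R} :=
  sf_product leb (counting01 R).
Let lam : {sigma_finite_measure set (mR * mR * mR)%type -> \bar R} :=
  sf_product lam2 leb.

Let H (A : set mR) (p : mR * mR) : \bar R :=
  \int[nuU]_u ((kU u * kL (u, p.1, p.2))%:E * \int[leb]_y (kY (u, y) * \1_A y)%:E).

(** The density with respect to [lam] of (A0, L, A1) on the event that Y lies in A. The value of A1
    enters only through [kA1]: the factor [H A], in which U and Y are integrated out, sees (a0, l)
    alone. *)
Let g (A : set mR) (t : mR * mR * mR) : \bar R :=
  (kA0 t.1.1 * kA1 t)%:E * H A t.1.

Let H_ge0 A p : 0 <= H A p.
Proof.
apply: integral_ge0 => u _; rewrite mule_ge0//.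
  by rewrite lee_fin mulr_ge0// ?(kU_ge0 F)// (kL_ge0 F).
by apply: integral_ge0 => y _; rewrite lee_fin mulr_ge0// (kY_ge0 F).
Qed.

Let g_ge0 A t : 0 <= g A t.
Proof. by rewrite mule_ge0// lee_fin mulr_ge0// ?(kA0_ge0 F)// (kA1_ge0 F). Qed.

Let mYA A : measurable A ->
  measurable_fun setT (fun p : mR * mR => (kY p * \1_A p.2)%:E : \bar R).
Proof.
move=> mA; apply/measurable_EFinP; apply: measurable_funM; first exact: mkY F.
exact: (measurableT_comp (measurable_indic mA) measurable_snd).
Qed.

Let mH A : measurable A -> measurable_fun setT (H A).
Proof.
move=> mA.
pose f (q : mR * mR * mR) := (kU q.2 * kL (q.2, q.1.1, q.1.2))%:E *
   fubini_F leb (fun p : mR * mR => (kY p * \1_A p.2)%:E) q.2.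
apply: (@measurable_fun_fubini_tonelli_F _ _ _ _ _ nuU f).
  apply: emeasurable_funM.
    apply/measurable_EFinP; apply: measurable_funM.
      exact: (measurableT_comp (mkU F) measurable_snd).
    apply: (measurableT_comp (mkL F)).
    by do 2?apply: measurable_fun_pair => //; exact: measurableT_comp.
  apply: (measurableT_comp _ measurable_snd).
  apply: measurable_fun_fubini_tonelli_F; first exact: mYA.
  by move=> p; rewrite lee_fin mulr_ge0// (kY_ge0 F).
move=> q; rewrite mule_ge0//.
  by rewrite lee_fin mulr_ge0// ?(kU_ge0 F)// (kL_ge0 F).
by apply: integral_ge0 => y _; rewrite lee_fin mulr_ge0// (kY_ge0 F).
Qed.

Let mg A : measurable A -> measurable_fun setT (g A).
Proof.
move=> mA; apply: emeasurable_funM.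
  apply/measurable_EFinP; apply: measurable_funM; last exact: mkA1 F.
  by apply: (measurableT_comp (mkA0 F)); exact: measurableT_comp.
exact: (measurableT_comp (mH mA) measurable_fst).
Qed.

Let marginal (phi : mR * mR * mR -> R) (A : set mR) :
  measurable_fun setT phi -> (forall t, 0 <= phi t)%R -> measurable A ->
  \int[wmeasure nuU]_w
    (phi (@proj_A0LA1 R w) * \1_A (wcoord wY w) * dag_density kU kA0 kL kA1 kY w)%:E
  = \int[lam]_t ((phi t)%:E * g A t).
Proof.
move=> mphi phi0 mA; have [_ _ mp] := measurable_proj R.
transitivity (\int[lam]_t \int[nuU]_u \int[leb]_y (phi t * \1_A y *
    (kU u * (kA0 t.1.1 * (kL (u, t.1.1, t.1.2) * (kA1 t * kY (u, y))))))%:E).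
  pose f w := (phi (@proj_A0LA1 R w) * \1_A (wcoord wY w) *
    dag_density kU kA0 kL kA1 kY w)%:E.
  have mf : measurable_fun setT f.
    apply/measurable_EFinP; apply: measurable_funM; last exact: measurable_dag_density F.
    apply: measurable_funM; first exact: measurableT_comp mphi mp.
    exact: (measurableT_comp (measurable_indic mA) (@measurable_wcoord R wY)).
  have f0 w : 0 <= f w by rewrite lee_fin !mulr_ge0// (dag_density_ge0 _ F).
  rewrite -/(f _).
  have := @fubini_tonelli_marginal _ _ _ _ _ _ _ _ _ _ R nuU leb
    (counting01 R) leb leb f mf f0.
  move=> e; rewrite /wmeasure; rewrite [LHS]e.
  by apply: eq_integral => -[[a0 l] a1] _.
apply: eq_integral => -[[a0 l] a1] _; rewrite /g /H /=.
have mI : measurable_fun setT (fun u => \int[leb]_y (kY (u, y) * \1_A y)%:E).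
  apply: (measurable_fun_fubini_tonelli_F _ (mYA mA)).
  by move=> p; rewrite lee_fin mulr_ge0// (kY_ge0 F).
have I0 u : 0 <= \int[leb]_y (kY (u, y) * \1_A y)%:E.
  by apply: integral_ge0 => y _; rewrite lee_fin mulr_ge0// (kY_ge0 F).
have UL0 u : (0 <= kU u * kL (u, a0, l))%R by rewrite mulr_ge0 ?(kU_ge0 F) ?(kL_ge0 F).
have mUL : measurable_fun setT (fun u => kU u * kL (u, a0, l))%R.
  apply: measurable_funM; first exact: mkU F.
  apply: (measurableT_comp (mkL F)).
  by do 2?apply: measurable_fun_pair.
have AA0 : (0 <= kA0 a0 * kA1 (a0, l, a1))%R.
  by rewrite mulr_ge0 ?(kA0_ge0 F) ?(kA1_ge0 F).
rewrite muleA -EFinM -ge0_integralZl//; last 3 first.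
- by apply: emeasurable_funM => //; exact/measurable_EFinP.
- by move=> u _; rewrite mule_ge0// lee_fin.
- by rewrite lee_fin mulr_ge0.
apply: eq_integral => u _.
rewrite muleA -EFinM -ge0_integralZl//; last 3 first.
- exact: measurable_fun_pair2 (mYA mA).
- by move=> y _; rewrite lee_fin mulr_ge0// (kY_ge0 F).
- by rewrite lee_fin !mulr_ge0 ?(kU_ge0 F) ?(kL_ge0 F) ?(kA0_ge0 F) ?(kA1_ge0 F).
by apply: eq_integral => y _; rewrite -EFinM; congr EFin; ring.
Qed.

Let law A E : measurable A -> measurable E ->
  P (wcoord wY @^-1` A `&` @proj_A0LA1 R @^-1` E) =
  \int[lam]_t ((\1_E t)%:E * g A t).
Proof.
move=> mA mE; have [_ _ mp] := measurable_proj R.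
rewrite (dag_densityP F); last first.
  apply: measurableI; rewrite -[X in measurable X]setTI.
    exact: measurable_wcoord.
  exact: mp.
rewrite -(@marginal (\1_E) A (measurable_indic mE) _ mA); last by [].
rewrite integral_mkcond; apply: eq_integral => w _.
rewrite epatch_indic indicI /= !indic_preimage -EFinM; congr EFin.
by rewrite mulrC (mulrC (\1_A _)).
Qed.

Let push (phi : mR * mR * mR -> R) E : measurable E ->
  measurable_fun setT phi -> (forall t, 0 <= phi t)%R ->
  \int[P]_(w in @proj_A0LA1 R @^-1` E) (phi (@proj_A0LA1 R w))%:E =
  \int[lam]_t ((\1_E t * phi t)%:E * g setT t).
Proof.
move=> mE mphi phi0; have [_ _ mp] := measurable_proj R.
have mf : measurable_fun setT (fun w => phi (@proj_A0LA1 R w)).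
  exact: measurableT_comp mphi mp.
rewrite (@ge0_integral_density _ _ R (wmeasure nuU) P
  (dag_density kU kA0 kL kA1 kY)); first last.
- by move=> w; rewrite lee_fin.
- exact/measurable_EFinP.
- by rewrite -[X in measurable X]setTI; exact: mp.
- by move=> G mG; exact: dag_densityP F _ mG.
- by move=> w; exact: dag_density_ge0 F.
- exact: measurable_dag_density F.
have mEphi : measurable_fun setT (fun t => \1_E t * phi t)%R.
  by apply: measurable_funM => //; exact: measurable_indic.
have Ephi0 t : (0 <= \1_E t * phi t)%R by rewrite mulr_ge0.
rewrite -(marginal mEphi Ephi0 measurableT) integral_mkcond; apply: eq_integral => w _.
rewrite epatch_indic indic_preimage -!EFinM; congr EFin.
by rewrite indicT mulr1 mulrC mulrA.
Qed.

Let integrable_g A : measurable A -> lam.-integrable setT (g A).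
Proof.
move=> mA; apply/integrableP; split; first exact: mg.
have -> : \int[lam]_t `|g A t| = P (wcoord wY @^-1` A `&` @proj_A0LA1 R @^-1` setT).
  rewrite law//; apply: eq_integral => t _.
  by rewrite gee0_abs ?g_ge0// indicT mul1e.
rewrite (le_lt_trans (probability_le1 _ _)) ?ltry//.
rewrite preimage_setT setIT -[X in measurable X]setTI; exact: measurable_wcoord.
Qed.

Let lam_sections (S : set (mR * mR * mR)) :
  (forall p x y, S (p, x) -> S (p, y) -> x = y) -> lam S = 0.
Proof.
move=> Ssub; transitivity (\int[lam2]_p leb (xsection S p)); first by [].
apply: integral0_eq => p _.
have [->|/set0P[x Sx]] := eqVneq (xsection S p) set0; first by rewrite measure0.
have -> : xsection S p = [set x].
  move: Sx; rewrite /xsection/= inE => Sx.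
  apply/seteqP; split => [y|y ->] /=; rewrite inE// => Sy.
  exact: Ssub Sy Sx.
exact: lebesgue_measure_set1.
Qed.

(** By [law] and [push], [g (J n)] and the Gaussian tail times [g setT] have equal integrals over
    every E, hence agree almost everywhere. Both contain the factor in [kA0] and [kA1]; cancelling
    it shows that the ratio of [H (J n)] to [H setT] at (a0, l) is the tail with mean
    [m (a0, l, a1)], for each admissible a1. If b were nonzero, [g setT] would vanish almost
    everywhere, although its integral is 1. *)
Lemma A1_coef_eq0 (m : mR * mR * mR -> R) (b s : R) : s != 0%R ->
  measurable_fun setT m ->
  (forall p x y, m (p, x) - m (p, y) = b * (x - y))%R ->
  (forall n E, measurable E ->
     P (wcoord wY @^-1` [set` `[n%:R, +oo[%R] `&` @proj_A0LA1 R @^-1` E) =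
     \int[P]_(w in @proj_A0LA1 R @^-1` E) (gauss_tail s n (m (@proj_A0LA1 R w)))%:E) ->
  b = 0%R.
Proof.
move=> s0 mm mb law_n; apply/eqP/negPn/negP => b0.
pose J n : set mR := [set` `[n%:R, +oo[%R].
have mJ n : measurable (J n) by exact: measurable_itv.
have mtail n : measurable_fun setT (fun t => gauss_tail s n (m t)).
  exact: measurableT_comp (measurable_gauss_tail n s0) mm.
have ae_n n : {ae lam, forall t, g (J n) t = (gauss_tail s n (m t))%:E * g setT t}.
  have : ae_eq lam setT (g (J n)) (fun t => (gauss_tail s n (m t))%:E * g setT t).
    apply: integral_ae_eq => //; first exact: integrable_g.
      by apply: emeasurable_funM; [exact/measurable_EFinP|exact: mg].
    move=> E _ mE.
    have := law_n n _ mE; rewrite law// => e.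
    have := push mE (mtail n) (fun t => gauss_tail_ge0 s n (m t)).
    rewrite -e => {}e.
    rewrite integral_mkcond [RHS]integral_mkcond.
    transitivity (\int[lam]_t ((\1_E t)%:E * g (J n) t)).
      by apply: eq_integral => t _; rewrite epatch_indic muleC.
    rewrite e; apply: eq_integral => t _.
    by rewrite epatch_indic EFinM -muleA muleC.
  by apply: filterS => t /(_ I).
have ae_fin : {ae lam, forall t, g setT t \is a fin_num}.
  by apply: filterS (integrable_ae measurableT (integrable_g measurableT)) => t /(_ I).
have [Z [mZ Z0 sZ]] : lam.-negligible (~` [set t |
    (forall n, g (J n) t = (gauss_tail s n (m t))%:E * g setT t) /\
    g setT t \is a fin_num]).
  by apply: filterS2 (ae_foralln ae_n) ae_fin => t; split.
have Zg t : ~ Z t -> (forall n, g (J n) t = (gauss_tail s n (m t))%:E * g setT t) /\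
    g setT t \is a fin_num.
  by move=> nZ; apply: contrapT => nt; apply: nZ; apply: sZ.
(* Given (a0, l), the law of Y does not depend on a1 on [S]; as b <> 0, the
   sections of [S] in a1 have at most one point. *)
pose S := ~` Z `&` [set t | g setT t != 0].
have S0 : lam S = 0.
  apply: lam_sections => p x y [/Zg[gx fx] /= gx0] [/Zg[gy fy] /= gy0].
  have key z : g setT (p, z) \is a fin_num -> g setT (p, z) != 0 ->
      (forall n, g (J n) (p, z) = (gauss_tail s n (m (p, z)))%:E * g setT (p, z)) ->
      [/\ H setT p \is a fin_num, H setT p != 0 &
        forall n, H (J n) p = (gauss_tail s n (m (p, z)))%:E * H setT p].
    rewrite /g /=; set r := (kA0 _ * _)%R => rHf rH0 rHn.
    have r0 : (0 < r)%R.
      rewrite lt_neqAle eq_sym; apply/andP; split; last first.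
        by rewrite mulr_ge0// ?(kA0_ge0 F)// (kA1_ge0 F).
      by apply: contraNneq rH0 => ->; rewrite mul0e.
    have H0 : H setT p != 0 by apply: contraNneq rH0 => ->; rewrite mule0.
    have Hfin : H setT p \is a fin_num.
      move: rHf; have := H_ge0 setT p; case: (H setT p) => [h| |]//.
      by rewrite gt0_muley ?lte_fin.
    have rK e : (r^-1)%:E * (r%:E * e) = e.
      by rewrite muleA -EFinM mulVf ?gt_eqF// mul1e.
    by split=> // n; rewrite -[LHS]rK rHn muleCA rK.
  have [hf h0 hx] := key x fx gx0 gx; have [_ _ hy] := key y fy gy0 gy.
  have : m (p, x) = m (p, y).
    apply: (gauss_tail_inj s0) => n; apply: (mul_fin_inj hf h0).
    by rewrite -hx -hy.
  move=> mxy; have := mb p x y; rewrite mxy subrr => /esym/eqP.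
  by rewrite mulf_eq0 (negbTE b0)/= subr_eq0 => /eqP.
have mgT := mg measurableT.
have mS : measurable S.
  apply: measurableI; first exact: measurableC.
  have -> : [set t | g setT t != 0] = ~` (g setT @^-1` [set 0]).
    by apply/seteqP; split=> t /= /eqP.
  by apply: measurableC; rewrite -[X in measurable X]setTI; exact: mgT.
have : \int[lam]_t g setT t = 0.
  transitivity (\int[lam]_t `|g setT t|).
    by apply: eq_integral => t _; rewrite gee0_abs.
  apply/(ae_eq_integral_abs _ measurableT mgT).2; exists (Z `|` S); split.
  - exact: measurableU.
  - by apply/eqP; rewrite -measure_le0 (le_trans (measureU2 _ _ _))//= Z0 S0 adde0.
  - move=> t /= /not_implyP[_ gt0]; have [Zt|nZt] := pselect (Z t); [by left|right].
    by split=> //=; apply/eqP.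
have := @law setT setT measurableT measurableT.
rewrite !preimage_setT setIT probability_setT => e1 e2.
have : 1 = 0 :> \bar R.
  rewrite e1 -e2; apply: eq_integral => t _.
  by rewrite indicT mul1e.
by move=> /eqP; rewrite onee_eq0.
Qed.

End ThetaThree.

(** Here p(X) plays the conditional probability of D given X: the law of X under P restricted to D
    has density [p] with respect to the law of X. It serves for L = 1, for L = 0, and with constant
    [p] for independence. *)
Lemma ge0_integral_cond d (T : measurableType d) (R : realType)
    (P : probability T R) (X : {mfun T >-> R}) (D : set T) (p h : R -> R)
    (B : set R) : measurable D -> measurable B ->
  measurable_fun setT p -> (forall a, 0 <= p a) ->
  measurable_fun setT h -> (forall a, 0 <= h a) ->
  (forall C : set R, measurable C ->
    P (D `&` X @^-1` C) = \int[distribution P X]_(a in C) (p a)%:E)%E ->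
  (\int[P]_(w in X @^-1` B `&` D) (h (X w))%:E =
   \int[distribution P X]_(a in B) (p a * h a)%:E)%E.
Proof.
move=> mD mB mp p0 mh h0 PD.
have mX : measurable_fun setT X by [].
have mXB C : measurable C -> measurable (X @^-1` C).
  by move=> mC; rewrite -[X in measurable X]setTI; exact: mX.
have mhX : measurable_fun setT (fun w => (h (X w))%:E).
  by apply/measurable_EFinP; exact: measurableT_comp.
pose push : {measure set R -> \bar R} := pushforward (mrestr P mD) X.
pose nu := push mX.
have nuE C : measurable C -> nu C = (\int[distribution P X]_(a in C) (p a)%:E)%E.
  by move=> mC; rewrite -PD// setIC.
transitivity (\int[nu]_(a in B) (h a)%:E)%E; last first.
  rewrite (ge0_integral_density mp p0 nuE mB).
  - by apply: eq_integral => a _; rewrite -EFinM mulrC.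
  - exact/measurable_EFinP.
  - by move=> a; rewrite lee_fin.
rewrite ge0_integral_pushforward//; last 2 first.
- by apply: measurable_funTS; exact/measurable_EFinP.
- by move=> a _; rewrite lee_fin.
have rE C : measurable C -> mrestr P mD C = (\int[P]_(w in C) (\1_D w)%:E)%E.
  by move=> mC; rewrite integral_indic// setIC.
rewrite (@ge0_integral_density _ _ R P (mrestr P mD) (\1_D))//; last 2 first.
- exact: mXB.
- by move=> w; rewrite lee_fin.
rewrite integral_mkcondr; apply: eq_integral => w _.
by rewrite epatch_indic.
Qed.

(** * The mixture law of Y given A0 *)

Section Mixture.
Variable R : realType.
Local Notation mR := (measurableTypeR R).
Local Notation leb := (@lebesgue_measure R).
Variables (P : probability (wspace R) R)
  (nuU : {sigma_finite_measure set mR -> \bar R}).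
Variables (kU kA0 : mR -> R) (kL kA1 : mR * mR * mR -> R) (kY : mR * mR -> R).
Hypothesis F : dag_factors P nuU kU kA0 kL kA1 kY.
Local Open Scope ereal_scope.

Let mpre i (S : set mR) : measurable S -> measurable (@wcoord R i @^-1` S).
Proof. by move=> mS; rewrite -[X in measurable X]setTI; exact: measurable_wcoord. Qed.

Lemma L_binary (G : set (wspace R)) : measurable G ->
  P G = P (G `&` wcoord wL @^-1` [set 1%R]) + P (G `&` wcoord wL @^-1` [set 0%R]).
Proof.
move=> mG; pose D : set mR := ~` [set 0%R; 1%R].
have mD : measurable D by apply: measurableC; exact: measurable_01.
have PD0 : P (wcoord wL @^-1` D) = 0.
  apply: (L_01 F) => //.
  transitivity (@counting mR R (D `&` [set 0%R; 1%R])); first by [].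
  by rewrite setICl measure0.
have m1 : measurable (G `&` wcoord wL @^-1` [set 1%R]).
  by apply: measurableI => //; exact: mpre.
have m0 : measurable (G `&` wcoord wL @^-1` [set 0%R]).
  by apply: measurableI => //; exact: mpre.
rewrite -measureU//; last first.
  apply/seteqP; split => // w /= [[_ ->] [_ /eqP]].
  by rewrite oner_eq0.
apply/eqP; rewrite eq_le; apply/andP; split; last first.
  apply: le_measure; rewrite ?inE//; first exact: measurableU.
  by move=> w [[]|[]].
rewrite -[leRHS]adde0 -PD0.
apply: le_trans (measureU2 _ _ _); [|exact: measurableU|exact: mpre].
apply: le_measure; rewrite ?inE//.
  by apply: measurableU; [exact: measurableU|exact: mpre].
move=> w Gw; have [l1|l1] := pselect (wcoord wL w = 1%R); first by left; left.
have [l0|l0] := pselect (wcoord wL w = 0%R); first by left; right.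
by right => /= -[].
Qed.

Lemma A0_atomless (a : mR) : P (wcoord wA0 @^-1` [set a]) = 0.
Proof.
rewrite (kA0_density F)//; apply: null_set_integral => //.
  by apply: measurable_funTS; apply/measurable_EFinP; exact: mkA0 F.
exact: lebesgue_measure_set1.
Qed.

(** A null set cannot be the whole line, and it stays null when a point is added, since A0 has no
    atoms. Two values of A0 suffice to recover a slope. *)
Lemma A0_two_points (Z : set mR) : measurable Z -> P (wcoord wA0 @^-1` Z) = 0 ->
  exists a a' : mR, [/\ ~ Z a, ~ Z a' & a != a'].
Proof.
move=> mZ Z0.
have ex (Z' : set mR) : measurable Z' -> P (wcoord wA0 @^-1` Z') = 0 ->
    exists a, ~ Z' a.
  move=> mZ' Z'0; apply: contrapT => /forallNP Z'T.
  have : P (wcoord wA0 @^-1` setT) = 1 by rewrite preimage_setT probability_setT.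
  have -> : setT = Z' by apply/seteqP; split=> // a _; apply: contrapT; exact: Z'T.
  by rewrite Z'0 => /esym/eqP; rewrite onee_eq0.
have [a Za] := ex _ mZ Z0.
have [|a' /not_orP[Za' a'a]] :=
    ex (Z `|` [set a]) (measurableU _ _ mZ (measurable_set1 a)).
  apply/negligibleP; first exact: mpre (measurableU _ _ mZ (measurable_set1 a)).
  rewrite preimage_setU; apply: negligibleU; apply/negligibleP => //.
  - exact: mpre.
  - exact: A0_atomless.
by exists a, a'; split => //; apply/eqP => aa'; exact: a'a.
Qed.

(** Over every B, the mixture of tails and the constant [latent_mass] have the same integral against
    the law of A0, so they agree almost everywhere; the mixtures are then compared at two points
    outside the common null set. *)
Lemma mixture_coefs (theta0 theta1 theta2 s gamma0 gamma1 : R) : s != 0%R ->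
  (forall n E, measurable E ->
     P (wcoord wY @^-1` [set` `[n%:R, +oo[%R] `&` @proj_A0LA1 R @^-1` E) =
     \int[P]_(w in @proj_A0LA1 R @^-1` E)
       (gauss_tail s n (theta0 + theta1 * wcoord wA0 w + theta2 * wcoord wL w))%:E) ->
  (forall B : set mR, measurable B ->
    P (wcoord wL @^-1` [set 1%R] `&` wcoord wA0 @^-1` B) =
    \int[P]_(w in wcoord wA0 @^-1` B) (expit (gamma0 + gamma1 * wcoord wA0 w))%:E) ->
  theta1 = 0%R /\ (gamma1 = 0%R \/ theta2 = 0%R).
Proof.
move=> s0 M1 M2.
pose p a := expit (gamma0 + gamma1 * a).
pose h n c a := gauss_tail s n (theta0 + theta1 * a + c).
pose mu0 := distribution P (@wcoord R wA0).
have p01 a : (0 < p a < 1)%R by exact: expit_itv.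
have mp : measurable_fun setT p.
  apply: measurableT_comp; first exact: measurable_expit.
  by apply: measurable_funD => //; exact: measurable_funM.
have mh n c : measurable_fun setT (h n c).
  apply: measurableT_comp; first exact: measurable_gauss_tail.
  by do 2?apply: measurable_funD => //; exact: measurable_funM.
have h0 n c a : (0 <= h n c a)%R by exact: gauss_tail_ge0.
have p0 a : (0 <= p a)%R by case/andP: (p01 a) => /ltW.
have q0 a : (0 <= 1 - p a)%R by case/andP: (p01 a) => _ /ltW; rewrite subr_ge0.
have mq : measurable_fun setT (fun a => 1 - p a)%R by exact: measurable_funB.
have D1 (C : set R) : measurable C ->
    P (wcoord wL @^-1` [set 1%R] `&` wcoord wA0 @^-1` C) =
    \int[mu0]_(a in C) (p a)%:E.
  move=> mC; rewrite (M2 _ mC) ge0_integral_pushforward//.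
    by apply: measurable_funTS; exact/measurable_EFinP.
  by move=> a _; rewrite lee_fin.
(* Obtained by subtraction: the masses for L = 1 and L = 0 add up to P(A0 in C), and the first is
   finite. *)
have D0 (C : set R) : measurable C ->
    P (wcoord wL @^-1` [set 0%R] `&` wcoord wA0 @^-1` C) =
    \int[mu0]_(a in C) (1 - p a)%:E.
  move=> mC.
  have : P (wcoord wA0 @^-1` C) =
      \int[mu0]_(a in C) (p a)%:E + \int[mu0]_(a in C) (1 - p a)%:E.
    rewrite -ge0_integralD//; last 4 first.
    - by move=> a _; rewrite lee_fin.
    - by apply: measurable_funTS; exact/measurable_EFinP.
    - by move=> a _; rewrite lee_fin.
    - by apply: measurable_funTS; exact/measurable_EFinP.
    rewrite (eq_integral (cst 1)).
      by rewrite integral_cst// mul1e.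
    by move=> a _; rewrite -EFinD addrC subrK.
  rewrite L_binary; last exact: mpre.
  have addI (x y z : \bar R) : x \is a fin_num -> x + y = x + z -> y = z.
    by move=> fx e; rewrite -[LHS](addeK _ fx) (addeC y) e (addeC x) addeK.
  rewrite setIC D1// setIC; apply: addI.
  by rewrite -D1//; apply: fin_num_measure; apply: measurableI; exact: mpre.
have mix n (B : set R) : measurable B ->
    P (wcoord wA0 @^-1` B `&` wcoord wY @^-1` [set` `[n%:R, +oo[%R]) =
    \int[mu0]_(a in B) (p a * h n theta2 a + (1 - p a) * h n 0 a)%:E.
  move=> mB; set J : set mR := [set` `[n%:R, +oo[%R].
  have mJ : measurable J by exact: measurable_itv.
  have slice (l : R) :
      P ((wcoord wA0 @^-1` B `&` wcoord wY @^-1` J) `&` wcoord wL @^-1` [set l]) =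
      \int[P]_(w in wcoord wA0 @^-1` B `&` wcoord wL @^-1` [set l])
        (h n (theta2 * l)%R (wcoord wA0 w))%:E.
    (* A cylinder with a1 left free, since [M1] speaks of events in (A0, L, A1). *)
    pose E : set (mR * mR * mR) := (B `*` [set l]) `*` setT.
    have mE : measurable E by apply: measurableX => //; exact: measurableX.
    have EE : @proj_A0LA1 R @^-1` E = wcoord wA0 @^-1` B `&` wcoord wL @^-1` [set l].
      by apply/seteqP; split => w; [case=> -[? ?] _; split|case=> ? ?; split=> //; split].
    have -> : (wcoord wA0 @^-1` B `&` wcoord wY @^-1` J) `&` wcoord wL @^-1` [set l] =
        wcoord wY @^-1` J `&` @proj_A0LA1 R @^-1` E by rewrite EE setIAC setIC.
    rewrite -EE; transitivity (\int[P]_(w in @proj_A0LA1 R @^-1` E)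
       (gauss_tail s n (theta0 + theta1 * wcoord wA0 w + theta2 * wcoord wL w))%:E).
      exact: M1 n E mE.
    apply: eq_integral => w; rewrite inE => -[[_ lw] _].
    by rewrite /h (lw : wcoord wL w = l).
  rewrite (L_binary (measurableI _ _ (mpre wA0 mB) (mpre wY mJ))).
  rewrite !slice mulr1 mulr0.
  rewrite (ge0_integral_cond (mpre wL (measurable_set1 _)) mB mp p0 (mh n _) (h0 n _) D1).
  rewrite (ge0_integral_cond (mpre wL (measurable_set1 _)) mB mq q0 (mh n _) (h0 n _) D0).
  rewrite -ge0_integralD//.
  - by move=> a _; rewrite lee_fin mulr_ge0.
  - by apply: measurable_funTS; apply/measurable_EFinP; exact: measurable_funM.
  - by move=> a _; rewrite lee_fin mulr_ge0.
  - by apply: measurable_funTS; apply/measurable_EFinP; exact: measurable_funM.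
have ae_n n : {ae mu0, forall a, (p a * h n theta2 a + (1 - p a) * h n 0 a)%:E =
    latent_mass nuU kU kY [set` `[n%:R, +oo[%R]}.
  set J : set mR := [set` `[n%:R, +oo[%R].
  have mJ : measurable J by exact: measurable_itv.
  have fJ := latent_mass_fin F mJ.
  have : ae_eq mu0 setT (cst (latent_mass nuU kU kY J))
     (fun a => (p a * h n theta2 a + (1 - p a) * h n 0 a)%:E).
    apply: integral_ae_eq => //.
    - by rewrite -(fineK fJ); exact: finite_measure_integrable_cst.
    - by apply/measurable_EFinP; apply: measurable_funD; exact: measurable_funM.
    - move=> B _ mB; rewrite -mix// (dag_indep_A0_Y F)// integral_cst//.
      by rewrite muleC.
  by apply: filterS => a /(_ I) /= <-.
have [Z [mZ Z0 sZ]] := ae_foralln ae_n.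
have [a [a' [nZa nZa' aa']]] := A0_two_points mZ Z0.
have Za b : ~ Z b -> forall n, (p b * h n theta2 b + (1 - p b) * h n 0 b)%:E =
    latent_mass nuU kU kY [set` `[n%:R, +oo[%R].
  by move=> nZb; apply: contrapT => nt; apply: nZb; apply: sZ.
have key n : (p a * gauss_tail s n (theta0 + theta1 * a + theta2) +
       (1 - p a) * gauss_tail s n (theta0 + theta1 * a) =
     p a' * gauss_tail s n (theta0 + theta1 * a' + theta2) +
       (1 - p a') * gauss_tail s n (theta0 + theta1 * a'))%R.
  have := Za _ nZa n; rewrite -(Za _ nZa' n) /h !addr0.
  by move=> [].
have [mm pp] := gauss_mixture_inj s0 (p01 a) (p01 a') key.
(* Applied to the means and, after inverting [expit], to the linear predictors of L. *)
have cancel (x y b : R) : (x + b * a = y + b * a')%R -> x = y -> b = 0%R.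
  move=> e xy; rewrite xy in e; move/addrI/eqP: e; rewrite -subr_eq0 -mulrBr mulf_eq0.
  by rewrite subr_eq0 (negbTE aa') orbF => /eqP.
split; first exact: cancel mm erefl.
by case: pp => [/expit_inj e|]; [left; exact: cancel e erefl|right].
Qed.

End Mixture.

(** * Independence and faithfulness *)

Section Independence.
Context d (T : measurableType d) (R : realType) (P : probability T R).

Lemma sigma_of_set1 (I : finType) (X : I -> T -> R) (i : I) (E : set T) :
  sigma_of X [set` [set i]%SET] E ->
  exists2 A : set (measurableTypeR R), measurable A & E = X i @^-1` A.
Proof.
move=> sE.
have : preimage_set_system setT (X i) (@measurable _ (measurableTypeR R)) E.
  move: E sE; apply: smallest_sub.
    by apply: sigma_algebra_preimage; exact: sigma_algebra_measurable.
  by move=> E [j]; rewrite /= inE => /eqP ->.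
by move=> [A mA <-]; exists A; rewrite ?setTI.
Qed.

Lemma sigma_of_set0 (I : finType) (X : I -> T -> R) (E : set T) :
  sigma_of X [set` finset.set0] E -> E = set0 \/ E = setT.
Proof.
move: E; apply: (@smallest_sub _ _ _ [set E | E = set0 \/ E = setT]).
  split => /=; first by left.
    by move=> A [] ->; [right; rewrite setD0|left; rewrite setDv].
  move=> A hA; have [h|/existsNP[n nA]] := pselect (forall n, A n = set0).
    by left; rewrite bigcup0// => n _; exact: h.
  right; apply/seteqP; split=> // x _; exists n => //.
  by case: (hA n) => // ->.
by move=> E [j] /=; rewrite inE.
Qed.

(** The sigma-algebra of no variables contains only the empty and the full event, so the constant
    P(G) is a version of the conditional probability of G, and these constants multiply. *)
Lemma indep_cond_indep (I : finType) (X : I -> T -> R) (i j : I) :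
  (forall k, measurable_fun setT (X k)) ->
  (forall A B : set (measurableTypeR R), measurable A -> measurable B ->
    P (X i @^-1` A `&` X j @^-1` B) = P (X i @^-1` A) * P (X j @^-1` B))%E ->
  cond_indep P X [set` [set i]%SET] [set` [set j]%SET] [set` finset.set0].
Proof.
move=> mX XX E F /sigma_of_set1[A mA ->] /sigma_of_set1[B mB ->].
have mpre k (S : set (measurableTypeR R)) : measurable S -> measurable (X k @^-1` S).
  by move=> mS; rewrite -[S in X in measurable X]setTI; exact: mX.
have cst_cond G : measurable G ->
    is_cond_prob P (sigma_of X [set` finset.set0]) G (cst (fine (P G))).
  move=> mG; split.
  - move=> S [C mC <-]; rewrite setTI preimage_cst; case: ifP => _.
      exact: (@measurableT _ (sigma_of_type X [set` finset.set0])).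
    exact: (@measurable0 _ (sigma_of_type X [set` finset.set0])).
  - exact: finite_measure_integrable_cst.
  - move=> S /sigma_of_set0[] ->; first by rewrite integral_set0 setI0 measure0.
    transitivity (\int[P]_w cst (fine (P G))%:E w)%E; first by [].
    rewrite integral_cst//= probability_setT mule1 setIT fineK//.
    exact: fin_num_measure.
exists (cst (fine (P (X i @^-1` A)))), (cst (fine (P (X j @^-1` B)))),
  (cst (fine (P (X i @^-1` A `&` X j @^-1` B)))); split.
- exact/cst_cond/mpre.
- exact/cst_cond/mpre.
- by apply: cst_cond; apply: measurableI; exact: mpre.
- apply: aeW => w /=; rewrite XX// fineM//; apply: fin_num_measure; exact: mpre.
Qed.

(** [ge0_integral_cond] with a constant conditional probability handles the positive and negative
    parts of X; integrability allows their subtraction. *)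
Lemma indep_event_integral (X : {mfun T >-> R}) (D : set T) : measurable D ->
  (forall C : set R, measurable C -> P (D `&` X @^-1` C) = P D * P (X @^-1` C))%E ->
  P.-integrable setT (EFin \o X) ->
  (\int[P]_(w in D) (X w)%:E = P D * \int[P]_w (X w)%:E)%E.
Proof.
move=> mD XD iX; pose c := fine (P D).
have cE : P D = c%:E by rewrite fineK// fin_num_measure.
have c0 : 0 <= c by exact: fine_ge0.
have key (h : R -> R) : measurable_fun setT h -> (forall a, 0 <= h a) ->
    (\int[P]_(w in D) (h (X w))%:E = c%:E * \int[P]_w (h (X w))%:E)%E.
  move=> mh h0.
  have := @ge0_integral_cond _ _ R P X D (cst c) h setT mD measurableT
    (measurable_cst _) (fun=> c0) mh h0.
  rewrite preimage_setT setTI => ->; last first.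
    move=> C mC; rewrite XD// cE.
    transitivity (\int[distribution P X]_(a in C) cst c%:E a)%E; last by [].
    by rewrite integral_cst.
  under eq_integral do rewrite EFinM.
  rewrite ge0_integralZl_EFin//; last 2 first.
  - by move=> a _; rewrite lee_fin.
  - exact/measurable_EFinP.
  rewrite ge0_integral_pushforward//.
  - exact/measurable_EFinP.
  - by move=> a _; rewrite lee_fin.
have mp : measurable_fun setT (fun a : R => Num.max a 0).
  by apply: measurable_maxr.
have mn : measurable_fun setT (fun a : R => Num.max (- a) 0).
  by apply: measurable_maxr => //; exact: measurable_oppr.
have epos S : (\int[P]_(w in S) (EFin \o X)^\+ w =
    \int[P]_(w in S) (Num.max (X w) 0)%:E)%E.
  by apply: eq_integral => w _; rewrite funeposE /= EFin_max.
have eneg S : (\int[P]_(w in S) (EFin \o X)^\- w =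
    \int[P]_(w in S) (Num.max (- X w) 0)%:E)%E.
  by apply: eq_integral => w _; rewrite funenegE /= EFin_max.
have fpos := integrable_fin_num measurableT (integrable_funepos measurableT iX).
have fneg := integrable_fin_num measurableT (integrable_funeneg measurableT iX).
rewrite cE integralE [X in (_ = _ * X)%E]integralE !epos !eneg.
rewrite (key _ mp) ?(key _ mn).
- rewrite epos in fpos; rewrite eneg in fneg.
  case: integral fpos => [a| |]// _; case: integral fneg => [b| |]// _.
  by rewrite -(EFinB a b) -!EFinM -EFinB mulrBr.
- by move=> a; rewrite le_max lexx orbT.
- by move=> a; rewrite le_max lexx orbT.
Qed.

(** Almost surely Z is the indicator of D, the event Z = 1, so the covariance is the integral of X
    over D minus P(D) E[X]. The bounds |X| <= 1 + X^2 and |X Z| <= X^2 + Z^2 provide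
    integrability. *)
Lemma covariance_indep_binary (X Z : {mfun T >-> R}) :
  P.-integrable setT (EFin \o (fun w => X w ^+ 2)) ->
  P.-integrable setT (EFin \o (fun w => Z w ^+ 2)) ->
  P (Z @^-1` (~` [set 0; 1])) = 0%E ->
  (forall C : set R, measurable C ->
    P (Z @^-1` [set 1%R] `&` X @^-1` C) = P (Z @^-1` [set 1%R]) * P (X @^-1` C))%E ->
  covariance P X Z = 0%E.
Proof.
move=> iX2 iZ2 Z01 XZ; pose D := Z @^-1` [set 1].
have mX : measurable_fun setT X by [].
have mZ : measurable_fun setT Z by [].
have mD : measurable D by rewrite -[X in measurable X]setTI; exact: mZ.
have iL (Y : {mfun T >-> R}) : P.-integrable setT (EFin \o (fun w => Y w ^+ 2)) ->
    P.-integrable setT (EFin \o Y).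
  move=> iY2; have mY : measurable_fun setT Y by [].
  apply: (@le_integrable _ _ R P _ measurableT _ (fun w => 1 + (Y w ^+ 2)%:E)%E).
  - exact/measurable_EFinP.
  - move=> w _ /=; rewrite lee_fin.
    rewrite [leRHS]ger0_norm ?addr_ge0// ?sqr_ge0//.
    by rewrite -[Y w ^+ 2]real_normK ?num_real//; have := sqr_ge0 (`|Y w| - 1); nra.
  - by apply: integrableD => //; exact: finite_measure_integrable_cst.
have iX := iL X iX2; have iZ := iL Z iZ2.
have aeZ : {ae P, forall w, Z w = \1_D w}.
  exists (Z @^-1` (~` [set 0; 1])); split => //.
    rewrite -[X in measurable X]setTI; apply: mZ => //; apply: measurableC.
    by apply: measurableU; exact: measurable_set1.
  move=> w /= ZD [Zw|Zw]; apply: ZD; rewrite Zw indicE.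
    by rewrite memNset// /D /= Zw => /esym/eqP; rewrite oner_eq0.
  by rewrite mem_set.
have iXZ : P.-integrable setT (EFin \o (X \* Z)).
  apply: (@le_integrable _ _ R P _ measurableT _
    (fun w => (X w ^+ 2)%:E + (Z w ^+ 2)%:E)%E).
  - by apply/measurable_EFinP; exact: measurable_funM.
  - move=> w _ /=; rewrite lee_fin normrM.
    rewrite [leRHS]ger0_norm ?addr_ge0// ?sqr_ge0//.
    rewrite -[X w ^+ 2]real_normK ?num_real// -[Z w ^+ 2]real_normK ?num_real//.
    have := sqr_ge0 (`|X w| - `|Z w|).
    by have := normr_ge0 (X w); have := normr_ge0 (Z w); nra.
  - exact: integrableD.
rewrite covarianceE; [|by apply/Lfun1_integrable..].
have EZ : ('E_P[Z] = P D)%E.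
  rewrite unlock.
  transitivity (\int[P]_w (\1_D w)%:E)%E; last by rewrite integral_indic// setIT.
  apply: ae_eq_integral => //; [exact/measurable_EFinP|exact/measurable_EFinP|].
  by apply: filterS aeZ => w /= ->.
have EXZ : ('E_P[(X * Z)%R] = \int[P]_(w in D) (X w)%:E)%E.
  rewrite unlock [RHS]integral_mkcond.
  apply: ae_eq_integral => //.
  - by apply/measurable_EFinP; exact: measurable_funM.
  - by apply: (measurable_restrictT _ mD).1; apply: measurable_funTS;
      exact/measurable_EFinP.
  - by apply: filterS aeZ => w /= e _; rewrite epatch_indic /= -EFinM -e.
rewrite EXZ indep_event_integral// EZ unlock muleC subee//.
by apply: fin_numM; [exact: integrable_fin_num|exact: fin_num_measure].
Qed.

End Independence.

Section NoBinaryIndep.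
Variables (R : realType) (P : probability (wspace R) R).
Variables (nuU : {sigma_finite_measure set (measurableTypeR R) -> \bar R})
  (kU kA0 : measurableTypeR R -> R)
  (kL kA1 : measurableTypeR R * measurableTypeR R * measurableTypeR R -> R)
  (kY : measurableTypeR R * measurableTypeR R -> R).
Hypothesis F : dag_factors P nuU kU kA0 kL kA1 kY.
Local Notation mR := (measurableTypeR R).
Local Notation L1 := (@wcoord R wL @^-1` [set 1]).
Local Notation L0 := (@wcoord R wL @^-1` [set 0]).

Let mpre i (S : set mR) : measurable S -> measurable (@wcoord R i @^-1` S).
Proof. by move=> mS; rewrite -[X in measurable X]setTI; exact: measurable_wcoord. Qed.

(** The product formula passes from L = 1 to L = 0 by complement, and up to a null event {L in B} is
    determined by which of 0 and 1 belong to B. *)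
Lemma L_product (G : set (wspace R)) (B : set mR) : measurable G -> measurable B ->
  (P (G `&` L1) = P G * P L1)%E ->
  (P (G `&` wcoord wL @^-1` B) = P G * P (wcoord wL @^-1` B))%E.
Proof.
move=> mG mB G1.
have fP S : measurable S -> P S \is a fin_num by exact: fin_num_measure.
have mL1 : measurable L1 by exact: mpre (measurable_set1 _).
have mL0 : measurable L0 by exact: mpre (measurable_set1 _).
have G0 : (P (G `&` L0) = P G * P L0)%E.
  have := L_binary F mG; have := L_binary F measurableT.
  rewrite !setTI probability_setT G1 -(fineK (fP _ mG)) -(fineK (fP _ mL1))
    -(fineK (fP _ mL0)) -(fineK (fP _ (measurableI _ _ mG mL0))).
  move=> /eqP; rewrite -EFinD eqe => /eqP e1.
  rewrite -!EFinM -EFinD => -[e2]; congr EFin.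
  have : fine (P G) * 1 = fine (P G) * (fine (P L1) + fine (P L0)) by rewrite -e1.
  by lra.
have slice (l : R) (H : set (wspace R)) :
    (H `&` wcoord wL @^-1` B) `&` wcoord wL @^-1` [set l] =
    if l \in B then H `&` wcoord wL @^-1` [set l] else set0.
  case: ifPn => [|/negP] lB; apply/seteqP; split => w //=.
  - by move=> [[]].
  - by move=> [Hw wl]; split=> //; split=> //; rewrite /= wl; rewrite inE in lB.
  - by move=> [[_ wB] wl]; apply: lB; rewrite inE -wl.
have mLB := mpre wL mB.
rewrite (L_binary F (measurableI _ _ mG mLB)) (L_binary F mLB).
have := slice 1 setT; have := slice 0 setT; rewrite !setTI => -> ->; rewrite !slice.
case: ifP => _; case: ifP => _; rewrite ?measure0 ?adde0 ?add0e ?mule0//.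
by rewrite G1 G0 ge0_muleDr.
Qed.

(** With nothing conditioned on, independence of [wcoord i] and L refutes both notions of
    faithfulness: the first directly, the second because it makes the correlation vanish. *)
Lemma no_binary_indep i : i != wL ->
  ~ d_separated DAG1b [set i]%SET [set wL]%SET finset.set0 ->
  (forall A : set mR, measurable A ->
    P (wcoord i @^-1` A `&` L1) = (P (wcoord i @^-1` A) * P L1)%E) ->
  ~ (faithful P wcoord DAG1b \/ linearly_faithful P wcoord DAG1b).
Proof.
move=> iL dsep ind.
have prod (A B : set mR) : measurable A -> measurable B ->
    (P (wcoord i @^-1` A `&` wcoord wL @^-1` B) =
     P (wcoord i @^-1` A) * P (wcoord wL @^-1` B))%E.
  by move=> mA mB; apply: L_product => //; [exact: mpre|exact: ind].
have disj : [set i]%SET :&: [set wL]%SET = finset.set0.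
  by apply/setP => x; rewrite !inE; apply: contraNF iL => /andP[/eqP <- /eqP ->].
case=> [faith|[sq lin]]; apply: dsep.
  apply/(faith _ _ _ disj); rewrite ?finset.setI0//.
  apply: indep_cond_indep prod => k; exact: measurable_wcoord.
apply/(lin _ _ _ disj); rewrite ?finset.setI0//.
apply/matrixP => a b; rewrite !mxE.
have -> : enum_val a = i by have := enum_valP a; rewrite inE => /eqP.
have -> : enum_val b = wL by have := enum_valP b; rewrite inE => /eqP.
(* The regression term is a sum over the empty index set, so the numerator is the plain
   covariance. *)
rewrite big1 => [|k _]; last by have := enum_valP k; rewrite inE.
rewrite covariance_indep_binary ?subr0 ?mul0r//.
- exact: sq.
- exact: sq.
- apply: (L_01 F); first by apply: measurableC; exact: measurable_01.
  transitivity (@counting mR R (~` [set 0; 1] `&` [set 0; 1])); first by [].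
  by rewrite setICl measure0.
- by move=> C mC; rewrite setIC ind// muleC.
Qed.

End NoBinaryIndep.

(** * Incompatibility of the two models *)

Section Misspecified.
Variables (R : realType) (P : probability (wspace R) R)
  (Q : probability (vspace R) R).
Hypothesis QP : forall E, measurable E -> Q E = distribution P observed E.

Local Notation mR := (measurableTypeR R).

Lemma models_incompatible : represented_DAG1b P ->
  faithful P wcoord DAG1b \/ linearly_faithful P wcoord DAG1b ->
  M1_correct Q -> M2_correct Q -> False.
Proof.
move=> /represented_factors[nuU [kU [kA0 [kL [kA1 [kY F]]]]]] faith.
move=> /(M1_kernel QP)[t0 [t1 [t2 [t3 [s [s0 M1]]]]]] /(M2_kernel QP)[g0 [g1 M2]].
have tail n m : (normal_prob m s [set` `[n%:R, +oo[] = (gauss_tail s n m)%:E)%E.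
  by rewrite gauss_tailE.
have t30 : t3 = 0.
  pose m (t : mR * mR * mR) := t0 + t1 * t.1.1 + t2 * t.1.2 + t3 * t.2.
  apply: (A1_coef_eq0 F (m := m) s0).
  - by do 3?apply: measurable_funD => //; apply: measurable_funM => //;
      do ?apply: measurableT_comp.
  - by move=> [a0 l] x y; rewrite /m /=; ring.
  - move=> n E mE; rewrite (M1 _ _ (measurable_itv _) mE).
    by apply: eq_integral => w _; rewrite tail.
have [t10 cases] : t1 = 0 /\ (g1 = 0 \/ t2 = 0).
  apply: (mixture_coefs F s0 _ M2) => n E mE; rewrite (M1 _ _ (measurable_itv _) mE).
  by apply: eq_integral => w _; rewrite tail t30 mul0r addr0.
have mpre i (S : set mR) : measurable S -> measurable (@wcoord R i @^-1` S).
  by move=> mS; rewrite -[X in measurable X]setTI; exact: measurable_wcoord.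
case: cases => [g10|t20].
- apply: (@no_binary_indep _ P _ _ _ _ _ _ F wA0) faith => //.
    (* The path made of the single arrow A0 -> L has no interior vertex and cannot be blocked. *)
    move=> /(_ wA0 [:: wL]) /=; rewrite !inE => /(_ isT isT isT isT).
    by [].
  have M2c (A : set mR) : measurable A ->
      (P (wcoord wL @^-1` [set 1%R] `&` wcoord wA0 @^-1` A) =
       (expit g0)%:E * P (wcoord wA0 @^-1` A))%E.
    move=> mA; rewrite M2// -integral_cst; last exact: mpre.
    by apply: eq_integral => w _; rewrite g10 mul0r addr0.
  move=> A mA; rewrite setIC M2c//.
  (* Taking the whole line for A identifies [expit g0] with P(L = 1). *)
  have := M2c _ measurableT; rewrite preimage_setT setIT probability_setT mule1 => ->.
  by rewrite muleC.
- apply: (@no_binary_indep _ P _ _ _ _ _ _ F wY) faith => //.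
    (* On the path Y <- U -> L the vertex U is a fork outside the empty conditioning set, so the
       path is open. *)
    move=> /(_ wY [:: wU; wL]) /=; rewrite !inE => /(_ isT isT isT isT).
    by rewrite /triple_blocked /= inE.
  have M1c (A B : set mR) : measurable A -> measurable B ->
      (P (wcoord wY @^-1` A `&` wcoord wL @^-1` B) =
       normal_prob t0 s A * P (wcoord wL @^-1` B))%E.
    move=> mA mB; pose E : set (mR * mR * mR) := ([set: mR] `*` B) `*` [set: mR].
    have EE : @proj_A0LA1 R @^-1` E = wcoord wL @^-1` B.
      by apply/seteqP; split => w; [case=> -[]|].
    have mE : measurable E by do 2?apply: measurableX.
    rewrite -EE (M1 _ _ mA mE).
    rewrite -integral_cst; last by rewrite EE; exact: mpre.
    by apply: eq_integral => w _; rewrite t10 t20 t30 !mul0r !addr0.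
  move=> A mA; rewrite M1c//; congr (_ * _)%E.
  have := M1c A setT mA measurableT; rewrite preimage_setT setIT probability_setT mule1.
  by move=> ->.
Qed.

End Misspecified.

Theorem lemma1 (R : realType) :
  (forall P : probability (wspace R) R,
     represented_DAG1b P ->
     faithful P wcoord DAG1b \/ linearly_faithful P wcoord DAG1b ->
     ~ M1_correct (distribution P observed) \/
     ~ M2_correct (distribution P observed)) /\
  F_par R `&` F_mar R = set0.
Proof.
split=> [P rep faith|].
  have [M1|] := pselect (M1_correct (distribution P observed)); last by left.
  by right; apply: models_incompatible rep faith M1.
apply/seteqP; split=> // Q [[_ [M1 M2]] [P [rep faith QP]]].
exact: (models_incompatible QP rep faith M1 M2).
Qed.
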